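(* For all integers $n,k$ with $3\leq k\leq n-1$, the generalized $3$-connectivity of the $(n,k)$-bubble-sort graph $B_{n,k}$ satisfies $\kappa_{3}(B_{n,k})=n-2$.
   Context: For positive integers $n>k$, let $[n]=\{1,\dots,n\}$ and let $P_{n,k}$ be the set of arrangements of $k$ elements of $[n]$, i.e. sequences $a_1a_2\cdots a_k$ of $k$ pairwise distinct elements of $[n]$. The $(n,k)$-bubble-sort graph $B_{n,k}$ is the simple undirected graph with vertex set $P_{n,k}$ in which two vertices $u=a_1a_2\cdots a_k$ and $v=b_1b_2\cdots b_k$ are adjacent if and only if one of the following holds: (a) there exists an integer $m\in[2,k]$ such that $a_{m-1}=b_m$, $a_m=b_{m-1}$ and $a_i=b_i$ for all $i\in[k]\setminus\{m-1,m\}$; (b) $a_i=b_i$ for all $i\in[k]\setminus\{1\}$ and $a_1\neq b_1$. For a graph $G$ and $S\subseteq V(G)$, $\kappa_G(S)$ denotes the maximum number $r$ of edge-disjoint trees $T_1,\dots,T_r$ in $G$, each connecting $S$ (i.e. $S\subseteq V(T_i)$), such that $V(T_i)\cap V(T_j)=S$ for all distinct $i,j\in\{1,\dots,r\}$. The generalized $3$-connectivity of $G$ is $\kappa_3(G)=\min\{\kappa_G(S) : S\subseteq V(G),\ |S|=3\}$. *)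

(* Defs.v *)
From mathcomp Require Import all_boot.

Set Implicit Arguments.
Unset Strict Implicit.
Unset Printing Implicit Defensive.

Record sgraph := SGraph {
  vertex :> finType;
  adj : rel vertex;
  adj_sym : symmetric adj;
  adj_irrefl : irreflexive adj
}.

Section Graph.
Variable G : sgraph.
Implicit Types (S V : {set G}) (E : {set {set G}}).

Definition edges : {set {set G}} := [set [set x; y] | x in G, y in adj x].

(* A pair (V, E), constrained to be a subgraph of G by [is_subgraph]. *)
Definition pregraph : predArgType := ({set G} * {set {set G}})%type.

Definition is_subgraph (H : pregraph) : bool :=
  (H.2 \subset edges) && [forall e in H.2, e \subset H.1].

Definition edge_rel E : rel G := fun x y => [set x; y] \in E.

Definition connected (H : pregraph) : bool :=
  [forall x in H.1, forall y in H.1, connect (edge_rel H.2) x y].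

(* Cyclic sequences of distinct vertices have length at most #|G|, so the bound
   on m is harmless (see [acyclicP]); those of length 2 merely traverse an edge
   back and forth. *)
Definition acyclic (H : pregraph) : bool :=
  [forall m : 'I_#|G|.+1, forall c : m.-tuple G,
     ucycleb (edge_rel H.2) c ==> (m <= 2)].

Definition is_tree (H : pregraph) : bool :=
  [&& is_subgraph H, H.1 != set0, connected H & acyclic H].

(* The families T_1, ..., T_r are represented as sets of trees. Nothing is lost
   for #|S| >= 2: a tree connecting S then has an edge, so that edge-disjoint
   trees with different indices are distinct (see [leq_kappa]). *)
Definition internally_disjoint_trees S (F : {set pregraph}) : bool :=
  [forall H in F, is_tree H && (S \subset H.1)] &&
  [forall H1 in F, forall H2 in F, (H1 != H2) ==>
     [disjoint H1.2 & H2.2] && (H1.1 :&: H2.1 == S)].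

Definition kappa S : nat :=
  \max_(F : {set pregraph} | internally_disjoint_trees S F) #|F|.

(* The minimum is initialised with the maximum of the same values, hence is
   attained as soon as G has at least three vertices (see [kappa3_min]). *)
Definition kappa3 : nat :=
  let M := \max_(S : {set G} | #|S| == 3) kappa S in
  \big[minn/M]_(S : {set G} | #|S| == 3) kappa S.

Lemma acyclicP (H : pregraph) :
  reflect (forall c : seq G, ucycle (edge_rel H.2) c -> size c <= 2)
          (acyclic H).
Proof.
apply: (iffP forallP) => [ac c cyc | ac m].
  have ltc : size c < #|G|.+1 by rewrite ltnS -(card_uniqP (proj2 (andP cyc))) max_card.
  by have /forallP/(_ (in_tuple c))/implyP := ac (Ordinal ltc); apply.
by apply/forallP => c; apply/implyP => /ac; rewrite size_tuple.
Qed.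

Lemma tree_has_edge S (H : pregraph) :
  1 < #|S| -> is_tree H -> S \subset H.1 -> H.2 != set0.
Proof.
move=> /card_gt1P [x [y [xS yS xy]]] /and4P[_ _ con _] sub.
apply/eqP => E0.
move/forall_inP: con => /(_ x (subsetP sub _ xS))/forall_inP.
move=> /(_ y (subsetP sub _ yS))/connectP[[|z p]] /=.
  by move=> _ eq_yx; rewrite eq_yx eqxx in xy.
by rewrite {1}/edge_rel E0 in_set0.
Qed.

Lemma leq_kappa S r : 1 < #|S| ->
  (r <= kappa S) <->
  (exists T : 'I_r -> pregraph,
     (forall i, is_tree (T i) /\ S \subset (T i).1) /\
     (forall i j, i != j ->
        [disjoint (T i).2 & (T j).2] /\ (T i).1 :&: (T j).1 = S)).
Proof.
move=> S2; split=> [|[T [tr dis]]].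
  have F0 : internally_disjoint_trees S set0.
    by apply/andP; split; apply/forall_inP => H; rewrite in_set0.
  have P0 : 0 < #|[pred F | internally_disjoint_trees S F]|.
    by apply/card_gt0P; exists set0.
  rewrite /kappa; have [F FP ->] := eq_bigmax_cond (fun F : {set pregraph} => #|F|) P0.
  move=> rF; case/andP: FP => /forall_inP tr /forall_inP dis.
  have mem (i : 'I_#|F|) := enum_valP i.
  exists (fun i => enum_val (widen_ord rF i)); split=> [i|i j ij].
    by have /andP[] := tr _ (mem (widen_ord rF i)).
  have := dis _ (mem (widen_ord rF i)).
  move/forall_inP/(_ _ (mem (widen_ord rF j)))/implyP.
  have ne : enum_val (widen_ord rF i) != enum_val (widen_ord rF j).
    by apply: contraNneq ij => /enum_val_inj/(congr1 val) /= /val_inj ->.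
  by move=> /(_ ne)/andP[? /eqP].
have injT : injective T.
  move=> i j eqT; apply/eqP; apply: contraT => /dis[].
  have [tj Sj] := tr j.
  by rewrite eqT -setI_eq0 setIid (negPf (tree_has_edge S2 tj Sj)).
have -> : r = #|[set T i | i : 'I_r]| by rewrite card_imset // card_ord.
rewrite /kappa; set A := [set _ | i : 'I_r].
apply: (@leq_bigmax_cond _ _ (fun F : {set pregraph} => #|F|) A).
apply/andP; split; apply/forall_inP => _ /imsetP[i _ ->].
  by apply/andP; exact: tr.
apply/forall_inP => _ /imsetP[j _ ->]; apply/implyP => ne.
have /dis[-> ->] : i != j by apply: contraNneq ne => ->.
by rewrite eqxx.
Qed.

Lemma kappa3_min : 2 < #|G| ->
  (exists2 S : {set G}, #|S| = 3 & kappa3 = kappa S) /\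
  (forall S : {set G}, #|S| = 3 -> kappa3 <= kappa S).
Proof.
move=> G3; split; last first.
  move=> S cS; rewrite /kappa3 /=; move: (\max_(A | _) _) => M.
  elim: (index_enum _) (mem_index_enum S) => // A s IH.
  rewrite inE big_cons => /predU1P[<-|/IH]; first by rewrite cS eqxx geq_minl.
  by case: ifP => // _; apply: leq_trans; exact: geq_minr.
have [S0 /eqP cS0] : exists S : {set G}, #|S| == 3.
  have : 0 < #|[set A : {set G} | #|A| == 3]| by rewrite card_draws bin_gt0.
  by case/card_gt0P => A; rewrite inE; exists A.
rewrite /kappa3 /=; apply: (big_ind (fun m => exists2 S : {set G}, #|S| = 3 & m = kappa S)).
- have P0 : 0 < #|[pred A : {set G} | #|A| == 3]|.
    by apply/card_gt0P; exists S0; rewrite inE cS0.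
  have [S /eqP cS ->] := eq_bigmax_cond kappa P0.
  by exists S.
- move=> a b [A cA ->] [B cB ->].
  by case: leqP => _; [exists A | exists B].
- by move=> A /eqP cA; exists A.
Qed.

End Graph.

(* Symbols and positions are numbered from 0: [n] is 'I_n, and the entry a_i is
   tnth a (i - 1). *)
Definition arrangement (n k : nat) : finType := {a : k.-tuple 'I_n | uniq a}.

Section BubbleSort.
Variables n k : nat.
Implicit Types u v : arrangement n k.

Definition swap_adj u v : bool :=
  let a := val u in let b := val v in
  [exists p : 'I_k, exists q : 'I_k,
    [&& val q == (val p).+1, tnth a p == tnth b q, tnth a q == tnth b p &
        [forall i, (i != p) && (i != q) ==> (tnth a i == tnth b i)]]].

Definition first_adj u v : bool :=
  let a := val u in let b := val v in
  [exists p : 'I_k,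
    [&& val p == 0, tnth a p != tnth b p &
        [forall i, (i != p) ==> (tnth a i == tnth b i)]]].

Definition bubble_adj : rel (arrangement n k) :=
  fun u v => swap_adj u v || first_adj u v.

Lemma bubble_adj_sym : symmetric bubble_adj.
Proof.
move=> u v; rewrite /bubble_adj /swap_adj /first_adj; congr (_ || _).
  apply: eq_existsb => p; apply: eq_existsb => q; congr (_ && _).
  rewrite (eq_sym (tnth (val u) p)) (eq_sym (tnth (val u) q)) andbCA.
  congr [&& _, _ & _]; apply: eq_forallb => i.
  by rewrite (eq_sym (tnth (val u) i)).
apply: eq_existsb => p; rewrite (eq_sym (tnth (val u) p)).
by congr [&& _, _ & _]; apply: eq_forallb => i; rewrite (eq_sym (tnth (val u) i)).
Qed.

Lemma bubble_adj_irrefl : irreflexive bubble_adj.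
Proof.
move=> u; apply/negP => /orP[] /existsP[p]; last by rewrite eqxx andbF.
move=> /existsP[q /and4P[/eqP pq /eqP + _ _]].
move/(tuple_uniqP _ (valP u))/(congr1 val)/eqP.
by rewrite /= pq -[X in X == _]addn0 -addn1 eqn_add2l.
Qed.

Definition bubble_sort_graph : sgraph :=
  SGraph bubble_adj_sym bubble_adj_irrefl.

End BubbleSort.

(* Main.v *)
Require Import Defs.
From mathcomp Require Import all_boot fingroup perm zify.

Set Implicit Arguments.
Unset Strict Implicit.
Unset Printing Implicit Defensive.

(** Every vertex of the graph has degree n - 1.  If x and y are adjacent and z is
    a third vertex, then n - 1 internally disjoint trees through x, y and z would
    use every edge at x, and every edge at y, exactly once.  The tree containing
    the edge xy would then have no further edge at x or y and could not reach z.
    So some triple allows at most n - 2 trees ([kappa_adjacent]).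

    For the lower bound, fix the last entries of the arrangements.  If only the
    first entry remains free, the arrangements with these entries form a clique.
    Otherwise they split into blocks according to the last free entry c.  Each
    block is a set of the same kind with one more entry fixed; exchanging the last
    two free entries matches every vertex with a vertex of another block, and any
    two blocks are joined by at least one such matched pair.  The number of blocks
    exceeds the degree by one.  [layered] records just this recursive structure,
    and the lower bound is proved for it by induction: any three vertices of a
    layered set of degree d + 2 admit d + 1 trees ([packing_layered]).

    It is convenient to look for vertex sets in place of trees ([packing]): d
    disjoint connected sets off S, each adjacent to all of S, and one more
    set that becomes connected once S is added.  Spanning trees of these sets
    together with S are the required trees: only the last one may use an edge
    inside S ([packing_kappa]).

    Three cases arise in the induction step.

    If S lies in one block, the induction hypothesis supplies all sets but one,
    and the union of the other blocks is the missing one, as every terminal is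
    matched into it ([packing_same]).

    If x and y lie in one block and z outside, Menger's theorem in the block gives
    enough disjoint connections between x and y.  Each is left at one vertex (the
    exceptional one, which may be the edge xy, at x), and the mates of these
    vertices are joined to z by a fan in the union of the other blocks
    ([packing_two_one]).

    If x, y and z lie in three different blocks, a whole fourth block j serves as
    the core of one tree: each terminal reaches, inside its own block, a vertex
    matched into j.  For the one remaining tree the fan of y also
    reaches the blocks of x and of z, and the fans of x and z aim at the two
    vertices where it arrives.  The fan of y thus needs one target for each of the
    other blocks, one more than the connectivity of its block provides; but y
    itself is matched into one of them and is its own target there
    ([packing_distinct]).

    The fans and connections rest on the connectivity of layered sets
    ([kconnected_layered]) and on Menger's theorem ([menger_paths]). *)

(** * Menger's theorem *)

Section Menger.
Variables (T : finType).
Implicit Types (e : rel T) (C D X A B : {set T}) (p : T * seq T).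

Definition within e C : rel T := [rel u v | [&& u \in C, v \in C & e u v]].

Definition vpath p : seq T := p.1 :: p.2.

Definition leads e A B p : bool :=
  [&& p.1 \in A, path e p.1 p.2 & last p.1 p.2 \in B].

Definition crosses e A B X : bool :=
  [exists a in A :\: X, exists b in B :\: X, connect (within e (~: X)) a b].

Lemma path_within e C a q :
  a \in C -> path (within e C) a q = path e a q && all (mem C) q.
Proof.
elim: q a => //= b q IH a aC; rewrite /within /= aC /=.
by case bC: (b \in C) => /=; rewrite ?andbF // IH // andbA.
Qed.

Lemma crossesP e A B X :
  reflect (exists2 p, leads e A B p & {in vpath p, forall v, v \notin X})
          (crosses e A B X).
Proof.
apply: (iffP exists_inP) => [[a] | [[a q] /and3P[/= aA pa lB] av]].
  rewrite inE => /andP[aX aA] /exists_inP[b]; rewrite inE => /andP[bX bB].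
  move/connectP=> [q]; rewrite path_within ?inE // => /andP[pa /allP qC] eb.
  exists (a, q); first by rewrite /leads /= aA pa -eb.
  by move=> v; rewrite inE => /predU1P[->|/qC] //=; rewrite inE.
have aX : a \notin X by apply: av; rewrite inE eqxx.
exists a; first by rewrite inE aX.
apply/exists_inP; exists (last a q); first by rewrite inE av // mem_last.
apply/connectP; exists q => //; rewrite path_within ?inE // pa /=.
by apply/allP => v vq /=; rewrite inE av // inE vq orbT.
Qed.

Definition del_arc e x y : rel T := [rel u v | e u v && ((u, v) != (x, y))].

(** The arc (x, y) can only be used after visiting x.  A path cut off at its first
    visit to a set containing x therefore survives the removal of that arc. *)
Lemma first_hit e x y D a q :
  x \in D -> path e a q -> has (mem D) (a :: q) ->
  exists q1, [/\ path (del_arc e x y) a q1, last a q1 \in D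
                & {subset a :: q1 <= a :: q}].
Proof.
move=> xD; elim: q a => [|b q IH] a /=.
  by move=> _; rewrite orbF => aD; exists [::]; split.
case/andP=> eab pb; case aD: (a \in D).
  by move=> _; exists [::]; split=> // v; rewrite !inE => /eqP->; rewrite eqxx.
move=> /(IH _ pb)[q1 [p1 l1 s1]]; exists (b :: q1); split=> //=.
  rewrite p1 andbT /del_arc /= eab; apply: contraFneq aD => -[-> _]; exact: xD.
by move=> v; rewrite inE => /predU1P[->|/s1]; rewrite !inE ?eqxx // => ->; rewrite orbT.
Qed.

(** Dually, the part of a path after its last visit to a set containing y cannot
    use the arc (x, y). *)
Lemma last_hit e x y D a q :
  y \in D -> path e a q -> has (mem D) (a :: q) ->
  exists c q1, [/\ path (del_arc e x y) c q1, c \in D, last c q1 = last a q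
                & {subset c :: q1 <= a :: q}].
Proof.
move=> yD; elim: q a => [|b q IH] a.
  by move=> _; rewrite /= orbF => aD; exists a, [::]; split.
case/andP=> eab pb; case hb: (has (mem D) (b :: q)).
  move=> _; have [c [q1 [p1 cD l1 s1]]] := IH _ pb hb.
  by exists c, q1; split=> // v /s1 vq; rewrite inE vq orbT.
rewrite -[has _ _]/(_ || has (mem D) (b :: q)) hb orbF => aD.
have out v : v \in b :: q -> v != y.
  move=> vq; apply: contraFneq hb => vy; apply/hasP; exists v => //.
  by rewrite vy.
exists a, (b :: q); split=> //=.
rewrite {1}/del_arc /= eab xpair_eqE (negPf (out b _)) ?inE ?eqxx // andbF /=.
have sub : {in predC1 y &, subrel e (del_arc e x y)}.
  by move=> u v _ /= vy euv; rewrite /del_arc /= euv xpair_eqE (negPf vy) andbF.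
by apply: (sub_in_path sub) pb; apply/allP.
Qed.

Definition disjoint_family (r : nat) (P : 'I_r -> T * seq T) :=
  forall i j v, v \in vpath (P i) -> v \in vpath (P j) -> i = j.

Lemma onto_of_card r (f : 'I_r -> T) D :
  injective f -> (forall i, f i \in D) -> #|D| = r ->
  forall s, s \in D -> exists i, f i = s.
Proof.
move=> injf fD cD s sD.
have : [set f i | i : 'I_r] = D.
  apply/eqP; rewrite eqEcard cD card_imset // card_ord leqnn andbT.
  by apply/subsetP => _ /imsetP[i _ ->].
by move/setP/(_ s); rewrite sD => /imsetP[i _ ->]; exists i.
Qed.

(** Induction on the number of arcs.  Remove an arc (x, y).  If the hypothesis
    breaks, fewer than r vertices S now separate A from B; as x |: S and y |: S
    separate them in the original graph, both have exactly r elements.  Without the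
    arc, r elements are still needed to separate A from x |: S, as well as y |: S
    from B, so the induction hypothesis gives r disjoint paths of each kind.  They
    meet only in S, and are glued there, the path ending at x being continued along
    the removed arc. *)
Theorem menger_paths e A B r :
  (forall X, #|X| < r -> crosses e A B X) ->
  exists2 P : 'I_r -> T * seq T,
    forall i, leads e A B (P i) && uniq (vpath (P i)) & disjoint_family P.
Proof.
have [m] := ubnP #|[set a : T * T | e a.1 a.2]|.
elim: m e A B => // m IH e A B; rewrite ltnS => em conn.
case: (pickP [pred a : T * T | e a.1 a.2]) => [[x y] /= exy | e0]; last first.
  have cAB : r <= #|A :&: B|.
    rewrite leqNgt; apply/negP => /conn /crossesP[[a q] /and3P[/= aA pa lB]].
    case: q pa lB => [_ aB av | b q]; last by have /= -> := e0 (a, b).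
    by move: (av a (mem_head _ _)); rewrite inE aA [a \in B]aB.
  exists (fun i => (enum_val (widen_ord cAB i), [::])) => [i | i j v].
    by have := enum_valP (widen_ord cAB i); rewrite inE /leads /= => /andP[-> ->].
  by rewrite /vpath /= !inE => /eqP-> /eqP/enum_val_inj/(congr1 val) /= /val_inj.
set e' := del_arc e x y.
have sub_e' : subrel e' e by move=> u v /andP[].
have arcs_e' : #|[set a : T * T | e' a.1 a.2]| < m.
  apply: leq_trans em; apply: proper_card; apply/properP; split.
    by apply/subsetP => -[u v]; rewrite !inE /= => /andP[].
  by exists (x, y); rewrite inE //= /e' /del_arc /= eqxx andbF.
have [/forallP conn' | ] := boolP [forall X : {set T}, (#|X| < r) ==> crosses e' A B X].
  have [X Xr | P leP disP] := IH e' A B arcs_e'; first exact: (implyP (conn' X)).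
  exists P => // i; case/andP: (leP i) => /and3P[a p l] u.
  by apply/andP; split=> //; apply/and3P; split=> //; apply: sub_path p.
rewrite negb_forall => /existsP[S]; rewrite negb_imply => /andP[Sr /crossesP sepS].
(* S separates without the arc; together with x or with y it separates with it. *)
have hitS a q : a \in A -> path e' a q -> last a q \in B ->
  exists2 s, s \in S & s \in a :: q.
  move=> aA pa lB; apply/exists_inP; apply: contra_notT sepS => /exists_inPn noS.
  exists (a, q); first by rewrite /leads /= aA pa.
  by move=> v vp; apply/negP => /noS; rewrite vp.
have hit z a q : (z == x) || (z == y) -> a \in A -> path e a q -> last a q \in B ->
    has (mem (z |: S)) (a :: q).
  move=> zxy aA pa lB; apply/negPn/negP => /hasPn noz.
  have nz v : v \in a :: q -> v != z by move=> /noz; rewrite !inE negb_or => /andP[].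
  have sub : {in predC1 z &, subrel e e'}.
    move=> u v /= uz vz euv; rewrite /e' /del_arc /= euv xpair_eqE /=.
    by apply/negP => /andP[/eqP ux /eqP vy]; move: zxy;
      rewrite -ux -vy !(eq_sym z) (negPf uz) (negPf vz).
  have pa' : path e' a q by apply: (sub_in_path sub) pa; apply/allP.
  have [s sS sq] := hitS _ _ aA pa' lB.
  by have := noz s sq; rewrite /= !inE sS orbT.
have cardz z : (z == x) || (z == y) -> #|z |: S| = r /\ z \notin S.
  move=> zxy; have rS : r <= #|z |: S|.
    rewrite leqNgt; apply/negP => /conn /crossesP[[a q] /and3P[/= aA pa lB] av].
    by have /hasP[v /av /negP] := hit z a q zxy aA pa lB.
  by move: rS; rewrite cardsU1; case: (z \in S) Sr => /=; lia.
have [cx xS] : #|x |: S| = r /\ x \notin S by apply: cardz; rewrite eqxx.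
have [cy yS] : #|y |: S| = r /\ y \notin S by apply: cardz; rewrite eqxx orbT.
have [X Xr | P leP disP] := IH e' A (x |: S) arcs_e'.
  have /crossesP[[a q] /and3P[/= aA pa lB] av] := conn X Xr.
  have [||q1 [p1 l1 s1]] := @first_hit e x y (x |: S) a q _ pa (hit x a q _ aA pa lB).
  - by rewrite setU11.
  - by apply/orP; left.
  by apply/crossesP; exists (a, q1) => [|v /s1 /av //]; rewrite /leads /= aA p1.
have [X Xr | Q leQ disQ] := IH e' (y |: S) B arcs_e'.
  have /crossesP[[a q] /and3P[/= aA pa lB] av] := conn X Xr.
  have [||c [q1 [p1 cD l1 s1]]] :=
    @last_hit e x y (y |: S) a q _ pa (hit y a q _ aA pa lB).
  - by rewrite setU11.
  - by apply/orP; right.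
  by apply/crossesP; exists (c, q1) => [|v /s1 /av //]; rewrite /leads /= cD p1 l1.
pose endP i := last (P i).1 (P i).2; pose begQ j := (Q j).1.
have endPv i : endP i \in vpath (P i) by rewrite /vpath mem_last.
have begQv j : begQ j \in vpath (Q j) by rewrite /vpath inE eqxx.
have ontoP := onto_of_card (f := endP) (D := x |: S) _ _ cx.
have {}ontoP s : s \in x |: S -> exists i, endP i = s.
  apply: ontoP => [i j eij | i]; last by case/andP: (leP i) => /and3P[].
  by apply: (disP i j (endP i)); rewrite // eij.
have ontoQ : forall s, s \in y |: S -> exists j, begQ j = s.
  apply: onto_of_card cy => [i j eij | j]; last by case/andP: (leQ j) => /and3P[].
  by apply: (disQ i j (begQ i)); rewrite // eij.
have S_endP i s : s \in S -> s \in vpath (P i) -> s = endP i.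
  move=> sS sPi; have [|i' ei'] := ontoP s; first by rewrite inE sS orbT.
  by rewrite -ei' (disP i i' s) // -ei'.
have S_begQ j s : s \in S -> s \in vpath (Q j) -> s = begQ j.
  move=> sS sQj; have [|j' ej'] := ontoQ s; first by rewrite inE sS orbT.
  by rewrite -ej' (disQ j j' s) // -ej'.
(* At a common vertex v one could switch from P i to Q j.  The resulting path meets
   S, whose elements occur only as ends of the P i and starts of the Q j; as these
   paths have no repeated vertex, the element of S is v itself. *)
have meet i j v : v \in vpath (P i) -> v \in vpath (Q j) ->
    [/\ v \in S, v = endP i & v = begQ j].
  move=> vP vQ; suff vS : v \in S by split=> //; [exact: S_endP | exact: S_begQ].
  have := leP i; have := leQ j; move: (S_endP i) (S_begQ j) vP vQ.
  rewrite /vpath /endP /begQ; case: (P i) (Q j) => [a q] [c q'] /= SP SQ vP vQ.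
  case/andP=> /and3P[/= cS pc lB] uc /andP[/and3P[/= aA pa lS] ua].
  case/splitPl: vP pa ua lS SP => q1 q2 lv;
    rewrite !last_cat cat_path lv => /andP[p1 _] ua lS SP.
  case/splitPl: vQ pc uc lB SQ => q3 q4 lv';
    rewrite !last_cat cat_path lv' => /andP[_ p4] uc lB SQ.
  have [|| s sS] := hitS a (q1 ++ q4) aA; rewrite ?cat_path ?last_cat ?lv ?p1 //.
  rewrite -cat_cons mem_cat => /orP[s1 | s4].
    have es : s = last v q2 by apply: SP => //; rewrite -cat_cons mem_cat s1.
    case: q2 es ua {SP lS} => [/= <- //|b q2 /= es].
    have sq2 : s \in b :: q2 by rewrite es mem_last.
    rewrite -[_ && _]/(uniq ((a :: q1) ++ b :: q2)) cat_uniq.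
    by case/and3P=> _ /hasPn/(_ _ sq2); rewrite /= s1.
  have es : s = c by apply: SQ => //; rewrite -cat_cons mem_cat s4 orbT.
  case: q3 lv' uc {SQ p4 lB} => [/= cv _ | b q3 /= lv']; first by rewrite -cv -es.
  by rewrite -es inE mem_cat s4 !orbT.
have /fin_all_exists[sg sgP] : forall i, exists j,
  begQ j = if endP i == x then y else endP i.
  move=> i; apply: ontoQ; case: ifP => [|ne]; first by rewrite setU11.
  have /andP[/and3P[_ _]] := leP i; rewrite -/(endP i) !inE ne /= => ->.
  by rewrite orbT.
have /fin_all_exists[R RP] : forall i, exists p, [/\ leads e A B p, uniq (vpath p) &
    forall v, v \in vpath p -> v \in vpath (P i) \/ v \in vpath (Q (sg i))].
  move=> i; have := sgP i; have := leP i; have := leQ (sg i).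
  rewrite /vpath /endP /begQ; case: (P i) (Q (sg i)) => [a q] [c q'] /=.
  case/andP=> /and3P[/= cS pc lB] uc /andP[/and3P[/= aA pa lS] ua] ec.
  have [q0 [p0 l0 s0]] : exists q0, [/\ path e a q0, last a q0 = last c q' &
      forall v, v \in a :: q0 -> v \in a :: q \/ v \in c :: q'].
    case: eqP ec => [lx|_] ec.
      exists (q ++ c :: q'); split; rewrite ?last_cat // ?cat_path /=.
        by rewrite (sub_path sub_e' pa) lx ec exy (sub_path sub_e') // -ec.
      by move=> v; rewrite -cat_cons mem_cat => /orP.
    exists (q ++ q'); rewrite ?last_cat -?ec //; split=> //.
      by rewrite cat_path (sub_path sub_e' pa) -ec (sub_path sub_e').
    move=> v; rewrite -cat_cons mem_cat => /orP[]; first by left.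
    by move=> vq; right; rewrite inE vq orbT.
  rewrite -l0 in lB; case/shortenP: p0 lB s0 {l0} => q1 p1 u1 s1 lB s0.
  exists (a, q1); split=> //=; first by rewrite /leads /= aA p1.
  move=> v vq; apply: s0; move: vq; rewrite !inE => /predU1P[->|/s1 ->];
    rewrite ?eqxx ?orbT //.
exists R => [i | i j v vi vj]; first by have [? ? _] := RP i; apply/andP.
have [_ _ /(_ v vi) Ri] := RP i; have [_ _ /(_ v vj) Rj] := RP j.
have mixed i1 j1 : v \in vpath (P i1) -> v \in vpath (Q (sg j1)) -> i1 = j1.
  move=> vP vQ; have [vS vi1 vj1] := meet _ _ _ vP vQ.
  move: (sgP j1); rewrite -vj1; case: eqP => [_ vy | _ vj2].
    by rewrite vy (negPf yS) in vS.
  by apply: (disP i1 j1 v); rewrite // vj2.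
case: Ri Rj => [vPi | vQi] [vPj | vQj];
  [exact: disP vPi vPj | exact: mixed | by apply/esym/mixed | ].
have eQ : sg i = sg j := disQ _ _ _ vQi vQj.
have : begQ (sg i) = begQ (sg j) by rewrite eQ.
rewrite !sgP => ee.
have endS i1 : endP i1 \in x |: S by have /andP[/and3P[]] := leP i1.
(* The gluing is injective even when the arc is a loop, that is y = x. *)
have noy i1 : endP i1 <> x -> y <> endP i1.
  move=> nx ey; have := endS i1; rewrite inE -{2}ey (negPf yS) orbF inE.
  by move/eqP.
suff eij : endP i = endP j by apply: (disP i j (endP i)); rewrite // eij.
case: eqP ee => [ei | ni]; case: eqP => [ej | nj] //; first by rewrite ei ej.
  by case/(noy j nj).
by move/esym; case/(noy i ni).
Qed.

End Menger.

(** * Connected sets, fans and bridges *)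

Section Linkage.
Variables (T : finType) (e : rel T).
Hypothesis e_sym : symmetric e.
Implicit Types (C D X A B S U V W F : {set T}).

Definition linked C : bool :=
  [forall u in C, forall v in C, connect (within e C) u v].

Lemma linkedP C :
  reflect {in C &, forall u v, connect (within e C) u v} (linked C).
Proof.
apply: (iffP forall_inP) => lC u => [v uC vC | uC].
  exact: (forall_inP (lC u uC)).
by apply/forall_inP => v; apply: lC.
Qed.

Lemma within_connect_sym C : connect_sym (within e C).
Proof.
apply: sym_connect_sym => u v; rewrite /within /= e_sym.
by case: (u \in C); case: (v \in C).
Qed.

Lemma connect_withinS C D u v :
  C \subset D -> connect (within e C) u v -> connect (within e D) u v.
Proof.
move=> /subsetP CD; apply: connect_sub => a b /and3P[aC bC eab].
by apply: connect1; rewrite /within /= !CD.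
Qed.

Lemma linked_hub C x : {in C, forall u, connect (within e C) x u} -> linked C.
Proof.
move=> hub; apply/linkedP => u v uC vC; apply: connect_trans (hub v vC).
by rewrite within_connect_sym hub.
Qed.

Lemma linked1 x : linked [set x].
Proof. by apply/linkedP => u v /set1P-> /set1P->. Qed.

Lemma linked0 : linked set0.
Proof. by apply/linkedP => u; rewrite inE. Qed.

Lemma linkedU C D u v :
  linked C -> linked D -> u \in C -> v \in D -> u = v \/ e u v ->
  linked (C :|: D).
Proof.
move=> /linkedP lC /linkedP lD uC vD uv.
have cuv : connect (within e (C :|: D)) u v.
  case: uv => [-> // | euv]; apply: connect1.
  by rewrite /within /= !inE uC vD orbT.
apply: (@linked_hub _ u) => w; rewrite inE => /orP[wC | wD].
  by apply: connect_withinS (lC u w uC wC); apply: subsetUl.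
by apply: connect_trans cuv _; apply: connect_withinS (lD v w vD wD); apply: subsetUr.
Qed.

Lemma linked_path a q : path e a q -> linked [set v in a :: q].
Proof.
elim: q a => [|b q IH] a /=.
  move=> _; suff -> : [set v in [:: a]] = [set a] by apply: linked1.
  by apply/setP => v; rewrite !inE.
case/andP=> eab /IH lq.
have -> : [set v in [:: a, b & q]] = a |: [set v in b :: q].
  by apply/setP => v; rewrite !inE.
apply: (linkedU (u := a) (v := b) (linked1 a) lq); rewrite ?inE ?eqxx //.
by right.
Qed.

Lemma first_step C x z :
  connect (within e C) x z -> x != z ->
  exists a, [/\ a \in C :\ x, e x a & connect (within e (C :\ x)) a z].
Proof.
case/connectP=> q pq ->; case/shortenP: pq => -[|a q'] /=; first by rewrite eqxx.
case/andP=> /and3P[xC aC exa] pq; rewrite inE negb_or -andbA => /and3P[xa xq _] _ _.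
have aCx : a \in C :\ x by rewrite !inE eq_sym xa.
exists a; split=> //; apply/connectP; exists q' => //.
move: pq; rewrite !path_within // => /andP[-> /allP qC] /=.
apply/allP => v vq; have /= vC := qC v vq; rewrite /= !inE vC andbT.
by apply: contraNneq xq => <-.
Qed.

(** Only the vertex sets of the disjoint paths matter below, which spares all
    bookkeeping of orientation and of ends. *)
Lemma menger_sets r V A B :
  A \subset V -> B \subset V ->
  (forall X, #|X| < r -> exists a b, [/\ a \in A :\: X, b \in B :\: X
                                      & connect (within e (V :\: X)) a b]) ->
  exists W : 'I_r -> {set T},
    [/\ forall i, W i \subset V /\ linked (W i),
        forall i, exists2 a, a \in A & a \in W i,
        forall i, exists2 b, b \in B & b \in W i
      & forall i j v, v \in W i -> v \in W j -> i = j].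
Proof.
move=> /subsetP AV /subsetP BV conn.
have [X Xr | P leP disP] := @menger_paths _ (within e V) A B r.
  have [a [b [aA bB cab]]] := conn X Xr.
  apply/exists_inP; exists a => //; apply/exists_inP; exists b => //.
  apply: connect_sub cab => u v /and3P[]; rewrite !inE => /andP[uX uV] /andP[vX vV] euv.
  by apply: connect1; rewrite /within /= !inE uX uV vX vV.
exists (fun i => [set v in vpath (P i)]); split=> i.
- have /andP[/and3P[aA]] := leP i; rewrite path_within ?AV // => /andP[pa /allP qV] _ _.
  split; last exact: linked_path.
  by apply/subsetP => v; rewrite !inE => /predU1P[->|/qV //]; apply: AV.
- have /andP[/and3P[aA _ _] _] := leP i; exists (P i).1 => //.
  by rewrite inE mem_head.
- have /andP[/and3P[_ _ lB] _] := leP i; exists (last (P i).1 (P i).2) => //.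
  by rewrite inE mem_last.
- by move=> j v; rewrite !inE; apply: disP.
Qed.

(** In contrast to the usual notion, small sets are not excluded: any clique is
    [kconnected] for every [d]. *)
Definition kconnected d U := forall X, #|X| < d -> linked (U :\: X).

(** [F] is the part off [y] of a path from [y] to [b].  It degenerates to the empty
    set when [y] is its own target, which allows a target to lie at the centre of a
    fan and saves a case distinction at each use. *)
Definition reaches y b F :=
  [/\ y \notin F, linked F &
      if b == y then F = set0 else b \in F /\ exists2 v, v \in F & e v y].

Lemma reaches_linked y b F : reaches y b F -> linked (y |: F) /\ b \in y |: F.
Proof.
case=> yF lF; case: eqP => [-> -> | _ [bF [v vF evy]]].
  by rewrite setU0 inE; split=> //; apply: linked1.
split; last by rewrite inE bF orbT.
by apply: (linkedU (linked1 y) lF (set11 y) vF); right; rewrite e_sym.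
Qed.

Lemma reaches_extend C u b y F :
  linked C -> u \in C -> e u b -> reaches y b F ->
  linked (C :|: F) /\ exists2 v, v \in C :|: F & e v y.
Proof.
move=> lC uC eub [yF lF]; case: eqP => [by_ -> | _ [bF [v vF evy]]].
  by rewrite setU0; split=> //; exists u; rewrite // -by_.
split; first by apply: (linkedU lC lF uC bF); right.
by exists v; rewrite // inE vF orbT.
Qed.

(** Menger's theorem in [U :\ y], between the neighbours of [y] and the targets.  A
    separating set of size less than [d] would also separate [y] from some target
    in [U].  There are as many sets as targets, so each contains exactly one. *)
Lemma fan d U y B :
  kconnected d U -> y \in U -> B \subset U -> #|B :\ y| <= d ->
  exists F : T -> {set T},
    {in B, forall b, F b \subset U /\ reaches y b (F b)} /\
    {in B &, forall b c v, v \in F b -> v \in F c -> b = c}.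
Proof.
move=> kU yU BU Bd; set r := #|B :\ y| in Bd.
have [||X Xr|W [WV WA WB disW]] :=
    @menger_sets r (U :\ y) [set a in U :\ y | e y a] (B :\ y).
- by apply/subsetP => v; rewrite inE => /andP[].
- exact: setSD.
- have [b bBX] : exists b, b \in B :\ y :\: X.
    apply/set0Pn; rewrite setD_eq0; apply/negP => /subset_leq_card.
    by rewrite leqNgt Xr.
  have eC : (U :\: (X :\ y)) :\ y = (U :\ y) :\: X.
    by apply/setP => v; rewrite !inE; case: (v == y); case: (v \in X).
  have /and3P[bX by_ bB] : [&& b \notin X, b != y & b \in B].
    by move: bBX; rewrite !inE.
  have [||a [aC eya cab]] := @first_step (U :\: (X :\ y)) y b.
  - apply: (linkedP _ (kU _ _));
      rewrite ?inE ?eqxx ?yU ?(negPf bX) ?andbF ?(subsetP BU) //.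
    by apply: leq_ltn_trans (subset_leq_card (subsetDl _ _)) (leq_trans Xr Bd).
  - by rewrite eq_sym.
  exists a, b; rewrite -eC; split=> //.
  by move: aC; rewrite eC !inE eya andbT.
have /fin_all_exists[f fP] : forall i, exists b, b \in B :\ y /\ b \in W i.
  by move=> i; have [b] := WB i; exists b.
have fW i : f i \in W i by case: (fP i).
have injf : injective f by move=> i j eij; apply: (disW i j (f i)); rewrite // eij.
have onto := onto_of_card injf (fun i => proj1 (fP i)) (erefl _).
exists (fun b => \bigcup_(i | f i == b) W i).
have FW i : \bigcup_(j | f j == f i) W j = W i.
  rewrite (bigD1 i) //= big1 ?setU0 // => j /andP[/eqP/injf->]; by rewrite eqxx.
have Fy : \bigcup_(j | f j == y) W j = set0.
  apply: big1 => j /eqP fy; have [] := fP j; by rewrite fy !inE eqxx.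
have Fcases b : b \in B -> b = y \/ exists i, b = f i.
  move=> bB; case: (eqVneq b y) => [|ne]; [by left | right].
  by have [|i <-] := onto b; [rewrite !inE ne | exists i].
split=> [b /Fcases[-> | [i ->]] | b c /Fcases[-> | [i ->]] /Fcases[-> | [j ->]] v];
  rewrite ?Fy ?FW ?inE //.
- by rewrite sub0set /reaches eqxx inE; split=> //; split=> //; apply: linked0.
- have [/subsetP WU lW] := WV i; split.
    by apply/subsetP => v /WU; rewrite !inE => /andP[].
  split=> //; first by apply/negP => /WU; rewrite !inE eqxx.
  case: eqP => [fy|_]; first by have [] := fP i; rewrite fy !inE eqxx.
  split=> //; have [a] := WA i; rewrite !inE => /andP[_ eya] aW.
  by exists a; rewrite // e_sym.
- by move=> vi vj; rewrite (disW i j v).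
Qed.

Definition bridge S W :=
  [/\ [disjoint S & W], linked W & {in S, forall s, exists2 v, v \in W & e v s}].

(** These sets describe r + 1 trees.  The tree of [None] is the one allowed to use
    edges inside [S], whence the weaker condition on its set, which may be empty. *)
Definition packing S U r :=
  exists (I : finType) (W : option I -> {set T}),
    [/\ #|I| = r, forall o, W o \subset U, forall i, bridge S (W (Some i)),
        linked (W None :|: S)
      & forall o o' v, v \in W o -> v \in W o' -> o = o'].

(** Menger's theorem between the neighbours of [x] and those of [y], off [x] and
    [y].  If [x] and [y] are adjacent, it yields [d] bridges and the edge xy takes
    the place of the last set; otherwise it yields [d.+1] bridges. *)
Lemma two_terminals d U x y :
  kconnected d.+1 U -> x \in U -> y \in U -> x != y ->
  d < #|[set v in U | e x v]| -> ~~ e x x -> ~~ e y y ->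
  packing [set x; y] U d.
Proof.
move=> kU xU yU xy degx exx eyy.
set V := U :\ x :\ y.
have bridgeW (W : {set T}) : W \subset V -> linked W ->
    (exists2 a, a \in [set a in V | e x a] & a \in W) ->
    (exists2 b, b \in [set b in V | e y b] & b \in W) -> bridge [set x; y] W.
  move=> /subsetP WV lW [a]; rewrite inE => /andP[_ exa] aW [b];
    rewrite inE => /andP[_ eyb] bW.
  split=> //.
    rewrite disjoints_subset; apply/subsetP => v /set2P[]->; rewrite inE;
      apply/negP => /WV.
      by rewrite !inE eqxx andbF.
    by rewrite !inE eqxx.
  by move=> s /set2P[]->; [exists a | exists b]; rewrite // e_sym.
(* It suffices to leave x by an edge avoiding y and to reach y without returning
   to x: the last edge into y then starts at a neighbour of y outside X. *)
have main r :
    (forall X, #|X| < r -> exists2 a, (a \in V :\: X) && e x a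
        & connect (within e (U :\: (X :\ x :\ y) :\ x)) y a) ->
    exists W : 'I_r -> {set T},
      [/\ forall i, W i \subset V, forall i, bridge [set x; y] (W i)
        & forall i j v, v \in W i -> v \in W j -> i = j].
  move=> conn.
  have [||X Xr|W [WV WA WB disW]] :=
    @menger_sets r V [set a in V | e x a] [set b in V | e y b].
  - by apply/subsetP => v; rewrite inE => /andP[].
  - by apply/subsetP => v; rewrite inE => /andP[].
  - have [a /andP[aVX exa] cya] := conn X Xr.
    have eC : (U :\: (X :\ x :\ y) :\ x) :\ y = V :\: X.
      by apply/setP => v; rewrite !inE; case: (v == y); case: (v == x); case: (v \in X).
    have ya : y != a by apply: contraTneq aVX => <-; rewrite !inE eqxx /= andbF.
    have [b [bC eyb cba]] := first_step cya ya.
    exists a, b; rewrite -eC; split.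
    - by move: aVX; rewrite !inE exa andbT.
    - by move: bC; rewrite eC !inE eyb andbT.
    - by rewrite within_connect_sym.
  by exists W; split=> // i; have [WVi lWi] := WV i;
    last exact: bridgeW WVi lWi (WA i) (WB i).
have cardX X : #|X :\ x :\ y| <= #|X|.
  by rewrite subset_leq_card // (subset_trans (subsetDl _ _)) ?subsetDl.
have VU : V \subset U by rewrite (subset_trans (subsetDl _ _)) ?subsetDl.
have [exy | nexy] := boolP (e x y).
  have [X Xd | W [WV Wb disW]] := main d.
    (* The edge xy must not be used to leave x: by its degree, x has another
       neighbour outside X, and deleting x as well is affordable. *)
    have [a] : exists a, a \in [set v in U | e x v] :\: (y |: X).
      apply/set0Pn; rewrite setD_eq0; apply/negP => /subset_leq_card.
      by rewrite cardsU1; case: (y \in X) => /=; lia.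
    rewrite !inE negb_or => /and3P[/andP[ay aX] aU exa].
    have ax : a != x by apply: contraNneq exx => {1}<-; rewrite e_sym.
    exists a; first by rewrite !inE aX ay ax aU exa.
    rewrite setDDl; apply: (linkedP _ (kU _ _));
      rewrite ?inE ?eqxx ?(negPf aX) ?(negPf ax) ?(eq_sym y) ?xy ?yU ?aU ?andbF //.
    by rewrite setUC cardsU1; have := cardX X; case: (x \in _) => /=; lia.
  exists 'I_d, (fun o => if o is Some i then W i else set0); split=> //.
  - by rewrite card_ord.
  - by move=> [i|]; rewrite ?sub0set // (subset_trans (WV i)).
  - by rewrite set0U; apply: (linkedU (linked1 x) (linked1 y) (set11 _) (set11 _));
      right.
  - by move=> [i|] [j|] v; rewrite ?inE // => vi vj; rewrite (disW i j v).
have [X Xd | W [WV Wb disW]] := main d.+1.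
  have [||a [aC exa caz]] := @first_step (U :\: (X :\ x :\ y)) x y; rewrite ?xy //.
    apply: (linkedP _ (kU _ _)); rewrite ?inE ?eqxx ?xU ?yU ?andbF //.
    by apply: leq_ltn_trans Xd.
  exists a; last by rewrite within_connect_sym.
  have ay : a != y by apply: contraNneq nexy => <-.
  by move: aC; rewrite !inE ay exa andbT /=; case: (a == x).
exists 'I_d, (fun o => if o is Some i then W (lift ord0 i) else W ord0); split=> //.
- by rewrite card_ord.
- by move=> [i|]; apply: subset_trans (WV _) VU.
- have [_ lW nb] := Wb ord0.
  have [|u uW eux] := nb x; rewrite ?inE ?eqxx //.
  have [|v vW evy] := nb y; rewrite ?inE ?eqxx ?orbT //.
  rewrite setUA.
  apply: (linkedU (u := v) _ (linked1 y) _ (set11 _)); rewrite ?inE ?vW //;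
    last by right.
  by apply: (linkedU lW (linked1 x) uW (set11 _)); right.
- move=> [i|] [j|] v vi vj //; first by have /lift_inj-> := disW _ _ v vi vj.
    by have := disW _ _ v vi vj.
  by have := disW _ _ v vi vj.
Qed.

End Linkage.

(** * Blocks joined by a matching *)

Section JoinedBlocks.
Variables (T : finType) (e : rel T).
Implicit Types (C D X A B S U V W F : {set T}).

Notation linked := (linked e).

Section Blocks.
Variables (I : finType) (part : T -> I) (mate : T -> T).
Implicit Types (J K : {set I}) (i j : I).

Definition blocks U K := [set u in U | part u \in K].

Definition block U j := [set u in U | part u == j].

Definition matched U J :=
  [/\ {in U, forall u, part u \in J},
      {in U, forall u, [/\ mate u \in U, e u (mate u), part (mate u) != part u
                         & mate (mate u) = u]}
    & {in J &, forall i j, i != j ->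
        exists2 u, u \in U & part u = i /\ part (mate u) = j}].

Definition gate U u0 i j :=
  odflt u0 [pick u in U | (part u == i) && (part (mate u) == j)].

Lemma gateP U J u0 : matched U J -> {in J &, forall i j, i != j ->
  [/\ gate U u0 i j \in U, part (gate U u0 i j) = i
    & part (mate (gate U u0 i j)) = j]}.
Proof.
case=> _ _ join i j iJ jJ ij; rewrite /gate;
  case: pickP => [u /and3P[uU /eqP ? /eqP ?] // | no].
by have [u uU [pu pmu]] := join i j iJ jJ ij; have := no u; rewrite /= uU pu pmu !eqxx.
Qed.

Section Matched.
Variables (U : {set T}) (J : {set I}).
Hypothesis mU : matched U J.

Let part_in u : u \in U -> part u \in J.
Proof. by case: mU => + _ _; apply. Qed.

Let mate_in u : u \in U ->
  [/\ mate u \in U, e u (mate u), part (mate u) != part u & mate (mate u) = u].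
Proof. by case: mU => _ + _; apply. Qed.

Lemma blocks_all : blocks U J = U.
Proof.
apply/setP => u; rewrite inE; case uU: (u \in U) => //=; exact: part_in.
Qed.

(** Two blocks are joined directly and through every third block.  These |K| - 1
    routes cross between blocks along disjoint matched pairs, so fewer than |K| - 1
    vertices cannot interrupt all of them. *)
Lemma blocks_linked K X :
  K \subset J -> {in K, forall j, linked (block U j :\: X)} -> #|X|.+1 < #|K| ->
  linked (blocks U K :\: X).
Proof.
move=> /subsetP KJ lK cX; apply/linkedP => u v;
  rewrite !inE => /and3P[uX uU uK] /and3P[vX vU vK].
set i := part u in uK *; set j := part v in vK *.
set C := blocks U K :\: X.
have in_block a w w' : a \in K -> w \in block U a :\: X ->
    w' \in block U a :\: X -> connect (within e C) w w'.
  move=> aK wa wa'; apply: connect_withinS (linkedP _ _ (lK a aK) w w' wa wa').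
  by apply/subsetP => t; rewrite !inE => /and3P[-> -> /eqP->].
have [eij | nij] := eqVneq i j.
  by apply: (in_block i); rewrite // !inE ?uX ?vX ?uU ?vU /= ?eqxx // -/j eij.
pose g := gate U u.
pose free a b := (g a b \notin X) && (mate (g a b) \notin X).
have gP a b : a \in K -> b \in K -> a != b ->
    [/\ g a b \in U, part (g a b) = a & part (mate (g a b)) = b].
  by move=> aK bK; apply: (gateP _ mU); apply: KJ.
have hop a b w :
    a \in K -> b \in K -> a != b -> free a b -> w \in block U a :\: X ->
    connect (within e C) w (mate (g a b)) /\ mate (g a b) \in block U b :\: X.
  move=> aK bK ab /andP[gX mgX] wa; have [gU pg pmg] := gP a b aK bK ab.
  have [mU' eg _ _] := mate_in gU; split; last by rewrite !inE mgX mU' pmg eqxx.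
  apply: (@connect_trans _ _ (g a b)); first by apply: (in_block a);
    rewrite // !inE gX gU pg eqxx.
  by apply: connect1; rewrite /within /= !inE gX mgX gU mU' pg pmg aK bK.
(* The routes from block i to block j through a third block l, together with the
   direct one (l = j), are |K| - 1 in number and use disjoint matched pairs.  The
   key of a vertex of such a pair is the route that the pair belongs to, so a set
   meeting every route has at least |K| - 1 elements. *)
have [l /andP[lK' li] /andP[fil flj]] :
    exists2 l, (l \in K) && (l != i) & free i l && ((l == j) || free l j).
  apply/exists_inP; apply: contraLR cX => /exists_inPn bad.
  pose route a b := if (a \in [set i; j]) && (b \in [set i; j]) then j
                    else if a \in [set i; j] then b else a.
  pose key w := route (part w) (part (mate w)).
  have keyg a b w : a \in K -> b \in K -> a != b ->
      (a \in [set i; j]) || (b \in [set i; j]) ->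
      w = g a b \/ w = mate (g a b) -> key w = route a b.
    move=> aK bK ab abij; have [gU pg pmg] := gP a b aK bK ab.
    have [_ _ _ mm] := mate_in gU; rewrite /key; case=> ->; rewrite ?mm pg pmg //.
    by move: abij; rewrite /route; case: (boolP (a \in _)); case: (boolP (b \in _)).
  have sub : K :\ i \subset key @: X.
    apply/subsetP => l; rewrite !inE andbC => lKi; have := bad l lKi;
      case/andP: lKi => lK' li.
    have hit a b : ~~ free a b -> exists2 w, w \in X & w = g a b \/ w = mate (g a b).
      by rewrite /free negb_and !negbK => /orP[] ?; eexists; eauto.
    rewrite negb_and => /orP[/hit[w wX wg] | ];
      last rewrite negb_or => /andP[nlj /hit[w wX wg]].
      apply/imsetP; exists w; rewrite // (keyg i l) /route // 1?eq_sym // !inE eqxx //=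
        (negPf li) /=.
      by case: eqP.
    apply/imsetP; exists w; rewrite // (keyg l j) /route // !inE ?eqxx ?orbT //=.
    by rewrite (negPf li) (negPf nlj).
  have := subset_leq_card sub; have := leq_imset_card key X.
  by rewrite (cardsD1 i K) uK; lia.
have [||c1 m1] := hop i l u uK lK' _ fil; rewrite 1?eq_sym // ?inE ?uX ?uU ?eqxx //.
have [elj | nlj] := eqVneq l j.
  by apply: connect_trans c1 (in_block l _ _ lK' m1 _); rewrite !inE vX vU elj eqxx.
rewrite (negPf nlj) in flj.
have [c2 m2] := hop l j _ lK' vK nlj flj m1.
by apply: connect_trans c1 (connect_trans c2 (in_block j _ _ vK m2 _));
  rewrite !inE vX vU eqxx.
Qed.

End Matched.
End Blocks.
End JoinedBlocks.

(** * Layered sets *)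

Lemma cards3P (T : finType) (S : {set T}) : #|S| = 3 ->
  exists x y z, [/\ S = [set x; y; z], x != y, y != z & x != z].
Proof.
move=> cS; have [x xS] : exists x, x \in S by apply/card_gt0P; rewrite cS.
have c2 : #|S :\ x| = 2 by have := cardsD1 x S; rewrite xS cS => -[].
have [y [z [yz eS]]] : exists y z, y != z /\ S :\ x = [set y; z].
  by have /eqP/cards2P[y [z [yz eS]]] := c2; exists y, z.
have [xy xz] : x != y /\ x != z.
  by apply/andP; rewrite -negb_or -in_set2 -eS !inE eqxx.
exists x, y, z; split=> //; by rewrite -setUA -eS (setD1K xS).
Qed.

Section Layered.
Variables (T : finType) (e : rel T).
Hypotheses (e_sym : symmetric e) (e_irr : irreflexive e).
Implicit Types (C D X A B S U V W F : {set T}).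

Notation linked := (linked e).

(** The number is the degree within the set.  The successors in the second
    constructor make every layered set of degree 1 a single edge. *)
Inductive layered : nat -> {set T} -> Prop :=
| LayeredClique d U of #|U| = d.+1 & {in U &, forall u v, u != v -> e u v} :
    layered d U
| LayeredStep d U (I : finType) (part : T -> I) (mate : T -> T) (J : {set I}) of
    matched e part mate U J & #|J| = d.+3
    & (forall j, j \in J -> layered d.+1 (block part U j)) :
    layered d.+2 U.

Lemma clique_linked U : {in U &, forall u v, u != v -> e u v} -> linked U.
Proof.
move=> clU; apply/linkedP => u v uU vU; have [-> // | uv] := eqVneq u v.
by apply: connect1; rewrite /within /= uU vU clU.
Qed.

Section Step.
Variables (d : nat) (U : {set T}) (I : finType) (part : T -> I) (mate : T -> T).
Variable J : {set I}.
Hypotheses (mU : matched e part mate U J) (cJ : #|J| = d.+3).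
Hypothesis kblock : forall j, j \in J -> kconnected e d.+1 (block part U j).

Let part_in u : u \in U -> part u \in J.
Proof. by case: mU => + _ _; apply. Qed.

Let mate_in u : u \in U ->
  [/\ mate u \in U, e u (mate u), part (mate u) != part u & mate (mate u) = u].
Proof. by case: mU => _ + _; apply. Qed.

Lemma block_linked j : j \in J -> linked (block part U j).
Proof.
by move=> jJ; rewrite -[block _ _ _]setD0; apply: (kblock jJ); rewrite ?cards0.
Qed.

Lemma kconnected_blocks (K : {set I}) :
  K \subset J -> d.+2 <= #|K| -> kconnected e d.+1 (blocks part U K).
Proof.
move=> KJ cK X cX; apply: (blocks_linked mU) => // [j jK | ];
  last exact: leq_ltn_trans cX cK.
by apply: kblock => //; apply: (subsetP KJ).
Qed.

(** A set of [d.+1] vertices may disconnect a block, but only by lying inside it.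
    The other blocks are then intact and jointly connected, and every remaining
    vertex of the damaged block is matched into them. *)
Lemma kconnected_step : kconnected e d.+2 U.
Proof.
move=> X cX.
case: (boolP [exists j in J, X \subset block part U j]) =>
  [/exists_inP[j jJ /subsetP Xj] | noj].
  pose H := blocks part U (J :\ j).
  have lH : linked H.
    rewrite -[H]setD0; apply: (kconnected_blocks _ _); rewrite ?cards0 ?subsetDl //.
    by have := cardsD1 j J; rewrite jJ; lia.
  have HC : H \subset U :\: X.
    apply/subsetP => v; rewrite !inE => /andP[vU /andP[vj _]]; rewrite vU andbT.
    by apply: contra vj => /Xj; rewrite inE => /andP[].
  have toH u : u \in U :\: X -> exists2 h, h \in H & connect (within e (U :\: X)) u h.
    rewrite inE => /andP[uX uU]; have [mu eu pu _] := mate_in uU.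
    have [pj | npj] := eqVneq (part u) j; last by exists u;
      rewrite // !inE uU npj part_in.
    have mH : mate u \in H by rewrite !inE mu part_in // -pj pu.
    exists (mate u) => //; apply: connect1;
      rewrite /within /= (subsetP HC _ mH) eu andbT.
    by rewrite inE uX uU.
  apply/linkedP => u v /toH[h hH cu] /toH[k kH cv].
  apply: connect_trans cu _; rewrite (within_connect_sym e_sym) in cv.
  by apply: connect_trans _ cv; apply: connect_withinS HC (linkedP _ _ lH h k hH kH).
rewrite -(blocks_all mU); apply: (blocks_linked mU) => // [j jJ | ];
  last by rewrite cJ ltnS.
have -> : block part U j :\: X = block part U j :\: (X :&: block part U j).
  by rewrite setDIr setDv setU0.
apply: kblock => //; rewrite -ltnS; apply: leq_trans cX; rewrite ltnS.
apply: proper_card; rewrite properE subsetIl subsetI subxx /=.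
by apply: contra noj => Xj; apply/exists_inP; exists j.
Qed.

Lemma degree_step :
  (forall j, j \in J -> {in block part U j, forall u,
     d < #|[set v in block part U j | e u v]|}) ->
  {in U, forall u, d.+1 < #|[set v in U | e u v]|}.
Proof.
move=> db u uU; have [mu eu pu _] := mate_in uU.
have ub : u \in block part U (part u) by rewrite inE uU eqxx.
have := db _ (part_in uU) u ub; rewrite -ltnS => /leq_trans; apply.
rewrite (cardsD1 (mate u) [set v in U | e u v]) inE mu eu add1n ltnS.
apply: subset_leq_card; apply/subsetP => v; rewrite !inE => /andP[/andP[-> /eqP pv] ->].
by rewrite !andbT; apply: contraNneq pu => <-; rewrite pv.
Qed.

(** A fan inside one block, indexed by the blocks into which its targets are matched:
    distinct indices have distinct targets. *)
Lemma star y i (L : {set I}) (t : I -> T) :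
  i \in J -> y \in block part U i ->
  {in L, forall j, t j \in block part U i /\ part (mate (t j)) = j} ->
  #|[set t j | j in L] :\ y| <= d.+1 ->
  exists F : I -> {set T},
    {in L, forall j, F j \subset block part U i /\ reaches e y (t j) (F j)} /\
    {in L &, forall j k v, v \in F j -> v \in F k -> j = k}.
Proof.
move=> iJ yi tL cL; have [|F [FU disF]] := fan e_sym (kblock iJ) yi _ cL.
  by apply/subsetP => _ /imsetP[j /tL[tj _] ->].
exists (fun j => F (t j)); split=> [j jL | j k jL kL v vj vk]; first by apply: FU;
  apply: imset_f.
have [_ <-] := tL j jL; have [_ <-] := tL k kL; congr (part (mate _)).
by apply: disF vj vk; apply: imset_f.
Qed.

(** The union of the other blocks is a bridge, as each terminal has its mate there. *)
Lemma packing_same S j :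
  j \in J -> S \subset block part U j ->
  (exists2 d', d = d'.+1 & packing e S (block part U j) d') -> packing e S U d.
Proof.
move=> jJ /subsetP Sj [d' dd [I0 [W [cI WU bW l0 disW]]]].
pose H := blocks part U (J :\ j).
have lH : linked H.
  rewrite -[H]setD0; apply: (kconnected_blocks _ _); rewrite ?cards0 ?subsetDl //.
  by have := cardsD1 j J; rewrite jJ; lia.
have WH o v : v \in W o -> v \in H -> False.
  by move=> /(subsetP (WU o)); rewrite !inE => /andP[_ ->]; rewrite andbF.
exists (option I0).
exists (fun o => if o is Some o' then oapp (fun i => W (Some i)) H o' else W None).
split.
- by rewrite card_option cI.
- move=> [[i|]|] /=; last first.
  + by apply: subset_trans (WU _) _; apply/subsetP => v; rewrite inE => /andP[].
  + by apply/subsetP => v; rewrite inE => /andP[].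
  by apply: subset_trans (WU _) _; apply/subsetP => v; rewrite inE => /andP[].
- move=> [i|] /=; first exact: bW.
  split=> //.
    rewrite disjoints_subset; apply/subsetP => s /Sj; rewrite !inE => /andP[_ ->].
    by rewrite andbF.
  move=> s /Sj; rewrite inE => /andP[sU /eqP sj]; have [ms es ps _] := mate_in sU.
  by exists (mate s); rewrite ?(e_sym _ s) // !inE ms part_in // -sj ps.
- exact: l0.
move=> [[i|]|] [[i'|]|] v //= vi vi'.
- by have [->] := disW _ _ _ vi vi'.
- by case: (WH _ _ vi vi').
- by have := disW _ _ _ vi vi'.
- by case: (WH _ _ vi' vi).
- by case: (WH _ _ vi' vi).
- by have := disW _ _ _ vi vi'.
- by case: (WH _ _ vi vi').
Qed.

(** The connections between [x] and [y] inside their block are extended to [z] by a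
    fan in the union of the other blocks, each through the mate of one of its
    vertices. *)
Lemma packing_two_one x y z :
  x \in U -> y \in U -> z \in U -> x != y -> part y = part x -> part z != part x ->
  (forall j, j \in J -> {in block part U j, forall u,
     d < #|[set v in block part U j | e u v]|}) ->
  packing e [set x; y; z] U d.
Proof.
move=> xU yU zU xy pyx pzx db; set i := part x in pyx pzx *.
have iJ : i \in J := part_in xU.
have xi : x \in block part U i by rewrite inE xU eqxx.
have yi : y \in block part U i by rewrite inE yU pyx eqxx.
have [||I0 [W [cI WU bW l0 disW]]] :=
  two_terminals e_sym (kblock iJ) xi yi xy (db i iJ x xi); rewrite ?e_irr //.
have /fin_all_exists[ex0 ex0P] : forall k, exists u, u \in W (Some k).
  by move=> k; have [_ _ /(_ x)] := bW k; rewrite !inE eqxx => /(_ isT)[u]; exists u.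
pose ex := oapp ex0 x.
have exi o : ex o \in block part U i.
  by case: o => [k|] //=; apply: (subsetP (WU _)) (ex0P k).
have exU o : ex o \in U by have := exi o; rewrite inE => /andP[].
have xW k : x \notin W (Some k).
  have [dW _ _] := bW k; have xS : x \in [set x; y] by rewrite !inE eqxx.
  by rewrite (disjointFr dW xS).
(* The set at [None] is left at x, which lies on no bridge. *)
have injex : injective (fun o => mate (ex o)).
  move=> o o' /(congr1 mate); have [_ _ _ ->] := mate_in (exU o);
    have [_ _ _ ->] := mate_in (exU o').
  case: o o' => [k|] [k'|] //= ekk.
  - by apply: (disW _ _ (ex0 k)); rewrite ?ex0P // ekk ex0P.
  - by have := xW k; rewrite -ekk ex0P.
  - by have := xW k'; rewrite ekk ex0P.
pose H := blocks part U (J :\ i); pose B := [set mate (ex o) | o : option I0].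
have kH : kconnected e d.+1 H.
  by apply: kconnected_blocks; rewrite ?subsetDl //; have := cardsD1 i J; rewrite iJ;
    lia.
have zH : z \in H by rewrite !inE zU pzx part_in.
have BH : B \subset H.
  apply/subsetP => _ /imsetP[o _ ->]; have [mU' _ pm _] := mate_in (exU o).
  rewrite !inE mU' part_in // andbT; apply: contraNneq pm => ->.
  by have := exi o; rewrite inE eq_sym => /andP[].
have [|F [FH disF]] := fan e_sym kH zH BH.
  by apply: leq_trans (subset_leq_card (subsetDl _ _)) _;
    rewrite card_imset // card_option cI.
have inB o : mate (ex o) \in B by apply: imset_f.
have HU v : v \in H -> v \in U by rewrite inE => /andP[].
have bH v : v \in block part U i -> v \in H -> False.
  by rewrite !inE => /andP[_ ->]; rewrite andbF.
exists I0, (fun o => W o :|: F (mate (ex o))); split=> //.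
- move=> o; rewrite subUset; have [/subsetP Fo _] := FH _ (inB o); apply/andP; split.
    by apply: subset_trans (WU o) _; apply/subsetP => v; rewrite inE => /andP[].
  by apply/subsetP => v /Fo /HU.
- move=> k; have [/subsetP Fk rk] := FH _ (inB (Some k)); have [dW lW nW] := bW k.
  have [_ eex _ _] := mate_in (exU (Some k)).
  have [lWF nz] := reaches_extend e_sym lW (ex0P k) eex rk.
  split=> //.
    rewrite disjoints_subset; apply/subsetP => s; rewrite !inE => sS.
    case/orP: sS => [sS | /eqP->].
      have sS' : s \in [set x; y] by rewrite !inE.
      rewrite (disjointFr dW sS') /=; apply/negP => /Fk; apply: bH.
      by case/orP: sS => /eqP->.
    case: rk => zF _ _; rewrite (negPf zF) orbF; apply/negP => zW.
    by apply: (bH z) zH; apply: (subsetP (WU _)) zW.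
  move=> s; rewrite !inE => /orP[sS | /eqP-> //].
  by have [|v vW evs] := nW s; [rewrite !inE | exists v; rewrite // inE vW].
- have [_ rN] := FH _ (inB None); have [lF bF] := reaches_linked e_sym rN.
  have [_ eex _ _] := mate_in xU.
  have -> : W None :|: F (mate (ex None)) :|: [set x; y; z]
            = (W None :|: [set x; y]) :|: (z |: F (mate (ex None))).
    apply/setP => v; rewrite !inE; case: (v \in W None); case: (v == x);
      case: (v == y); case: (v == z) => //=; by rewrite ?orbT ?orbF.
  apply: (linkedU e_sym l0 lF _ bF (u := x)); last by right.
  by rewrite !inE eqxx orbT.
move=> o o' v; rewrite !inE => /orP[vo | vo] /orP[vo' | vo'].
- exact: disW vo vo'.
- case: (bH v); first exact: (subsetP (WU o)).
  by have [/subsetP-> //] := FH _ (inB o').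
- case: (bH v); first exact: (subsetP (WU o')).
  by have [/subsetP-> //] := FH _ (inB o).
- exact/injex/(disF _ _ (inB o) (inB o') v vo vo').
Qed.

(** Each of the [d] blocks containing no terminal is the core of a bridge.  The last
    tree joins the block of [x] to that of [y], and the block of [y] to that of
    [z]. *)
Lemma packing_distinct x y z :
  x \in U -> y \in U -> z \in U ->
  part x != part y -> part z != part y -> part x != part z ->
  packing e [set x; y; z] U d.
Proof.
move=> xU yU zU; set i1 := part x; set i2 := part y; set i3 := part z => n12 n32 n13.
have [i1J i2J i3J] : [/\ i1 \in J, i2 \in J & i3 \in J] by rewrite !part_in.
have blockE i v : (v \in block part U i) = (v \in U) && (part v == i) by rewrite inE.
have [xb yb zb] : [/\ x \in block part U i1, y \in block part U i2
                    & z \in block part U i3].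
  by rewrite !blockE xU yU zU !eqxx.
pose g := gate part mate U x.
have gP i j : i \in J -> j \in J -> i != j ->
  g i j \in block part U i /\ part (mate (g i j)) = j.
  by move=> iJ jJ ij; have [gU pg pmg] := gateP x mU iJ jJ ij;
    rewrite blockE gU pg eqxx.
(* As y is its own exit to the block of its mate, a fan with d + 1 proper targets
   serves all the d + 2 other blocks. *)
pose ty j := if part (mate y) == j then y else g i2 j.
have tyP : {in J :\ i2, forall j, ty j \in block part U i2 /\ part (mate (ty j)) = j}.
  move=> j /setD1P[ji2 jJ]; rewrite /ty; case: eqP => [<- // | _].
  by apply: gP; rewrite // eq_sym.
have [my ey py _] := mate_in yU.
have cJ1 i : i \in J -> #|J :\ i| = d.+2.
  by move=> iJ; have := cardsD1 i J; rewrite iJ cJ => -[].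
have [|Fy [FyP disFy]] := star i2J yb tyP.
  have m2 : part (mate y) \in J :\ i2 by rewrite !inE py part_in.
  have sub : [set ty j | j in J :\ i2] :\ y \subset
             [set ty j | j in J :\ i2 :\ part (mate y)].
    apply/subsetP => v /setD1P[vy /imsetP[j jJ ev]]; apply/imsetP; exists j => //.
    rewrite in_setD1 jJ andbT; apply: contraNneq vy => ej.
    by rewrite ev /ty ej eqxx.
  apply: leq_trans (subset_leq_card sub) _; apply: leq_trans (leq_imset_card _ _) _.
  by have := cardsD1 (part (mate y)) (J :\ i2); rewrite m2 cJ1 // => -[->].
(* In the block i of another terminal w, the fan aims at the exits to the blocks
   other than i', but its exit to the block of y has to be the mate of the vertex
   through which the fan of y leaves for i: this is where the two fans join. *)
have side i i' (w : T) :
  i \in J -> i != i2 -> i' \in J -> i' != i2 -> i != i' -> w \in block part U i ->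
  exists (t : I -> T) (F : I -> {set T}), [/\ t i2 = mate (ty i),
    {in J :\ i :\ i', forall j, t j \in block part U i /\ part (mate (t j)) = j},
    {in J :\ i :\ i', forall j, F j \subset block part U i /\ reaches e w (t j) (F j)}
    & {in J :\ i :\ i' &, forall j k v, v \in F j -> v \in F k -> j = k}].
  move=> iJ ii2 i'J i'i2 ii' wb; pose t j := if j == i2 then mate (ty i) else g i j.
  have tP : {in J :\ i :\ i', forall j,
    t j \in block part U i /\ part (mate (t j)) = j}.
    move=> j; rewrite !in_setD1 => /and3P[_ ji jJ]; rewrite /t; case: eqP => [-> | _].
      have [] := tyP i; first by rewrite !inE ii2.
      rewrite !blockE => /andP[tU /eqP pt] pmt; have [mtU _ _ mm] := mate_in tU.
      by rewrite mtU pmt eqxx mm pt.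
    by apply: gP; rewrite // eq_sym.
  have [|F [FP disF]] := star iJ wb tP.
    apply: leq_trans (subset_leq_card (subsetDl _ _)) _;
      apply: leq_trans (leq_imset_card _ _) _.
    by have := cardsD1 i' (J :\ i); rewrite !inE i'J (eq_sym i') ii' cJ1 // => -[->].
  by exists t, F; split=> //; rewrite /t eqxx.
have [tx [Fx [tx2 txP FxP disFx]]] := side i1 i3 x i1J n12 i3J n32 n13 xb.
have [|tz [Fz [tz2 tzP FzP disFz]]] := side i3 i1 z i3J n32 i1J n12 _ zb;
  first by rewrite eq_sym.
pose K := J :\ i1 :\ i3 :\ i2.
have KP j : j \in K ->
    [/\ j \in J :\ i2, j \in J :\ i1 :\ i3, j \in J :\ i3 :\ i1 & j \in J].
  by rewrite !inE => /and4P[-> -> -> ->].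
have cK : #|K| = d.
  have h1 : #|J :\ i1 :\ i3| = #|K|.+1.
    by rewrite (cardsD1 i2) !in_setD1 i2J (eq_sym i2) n32 (eq_sym i2) n12.
  have h2 : #|J :\ i1| = #|J :\ i1 :\ i3|.+1.
    by rewrite (cardsD1 i3) in_setD1 i3J (eq_sym i3) n13.
  by move: h2; rewrite h1 cJ1 // => -[].
pose I0 : finType := {j : I | j \in K}.
(* The fan of x is used for the block of y by the last tree and for block j by the
   j-th bridge; [idx] merges the two cases. *)
pose core (o : option I0) := if o is Some j then block part U (val j) else set0.
pose idx i (o : option I0) := if o is Some j then val j else i.
pose W o := core o :|: Fx (idx i2 o) :|: (Fy (idx i1 o) :|: Fy (idx i3 o))
                   :|: Fz (idx i2 o).
have idx2x o : idx i2 o \in J :\ i1 :\ i3.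
  by case: o => [[j /KP[]] | ] //=; rewrite !inE (eq_sym i2) n32 (eq_sym i2) n12.
have idx2z o : idx i2 o \in J :\ i3 :\ i1.
  by case: o => [[j /KP[]] | ] //=; rewrite !inE (eq_sym i2) n12 (eq_sym i2) n32.
have idx1 o : idx i1 o \in J :\ i2 by case: o => [[j /KP[]] | ] //=; rewrite !inE n12.
have idx3 o : idx i3 o \in J :\ i2 by case: o => [[j /KP[]] | ] //=; rewrite !inE n32.
have inFx o v : v \in Fx (idx i2 o) -> v \in U /\ part v = i1.
  by have [/subsetP Fs _] := FxP _ (idx2x o); move/Fs; rewrite blockE => /andP[-> /eqP].
have inFz o v : v \in Fz (idx i2 o) -> v \in U /\ part v = i3.
  by have [/subsetP Fs _] := FzP _ (idx2z o); move/Fs; rewrite blockE => /andP[-> /eqP].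
have inFy j v : j \in J :\ i2 -> v \in Fy j -> v \in U /\ part v = i2.
  by move=> jJ; have [/subsetP Fs _] := FyP _ jJ; move/Fs;
    rewrite blockE => /andP[-> /eqP].
have inW o v : v \in W o ->
  [\/ [/\ v \in U, part v \in K & v \in core o],
      [/\ v \in U, part v = i1 & v \in Fx (idx i2 o)],
      [/\ v \in U, part v = i2 & v \in Fy (idx i1 o) \/ v \in Fy (idx i3 o)]
    | [/\ v \in U, part v = i3 & v \in Fz (idx i2 o)]].
  rewrite /W !in_setU -!orbA => /or4P[vc | vx | vy | /orP[vy | vz]].
  - apply: Or41; move: vc; case: (o) => [[j jK]|] /=; last by rewrite inE.
    by rewrite blockE => /andP[vU /eqP pv]; rewrite vU pv eqxx.
  - by have [vU pv] := inFx o v vx; apply: Or42.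
  - by have [vU pv] := inFy _ v (idx1 o) vy; apply: Or43; split=> //; left.
  - by have [vU pv] := inFy _ v (idx3 o) vy; apply: Or43; split=> //; right.
  - by have [vU pv] := inFz o v vz; apply: Or44.
have nK i : i \in [set i1; i2; i3] -> i \notin K.
  by rewrite !inE => /orP[/orP[]|] /eqP->; rewrite eqxx ?andbF.
have [m1 m2 m3] : [/\ i1 \in [set i1; i2; i3], i2 \in [set i1; i2; i3]
                    & i3 \in [set i1; i2; i3]].
  by rewrite !inE !eqxx !orbT.
have offx o : x \notin W o.
  apply/negP => /inW[] [_ px]; first by case/negP: (nK _ m1).
  - have [_ [/negP nx _ _]] := FxP _ (idx2x o); exact: nx.
  - by move: n12; rewrite /i1 px eqxx.
  - by move: n13; rewrite /i1 px eqxx.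
have offy o : y \notin W o.
  apply/negP => /inW[] [_ px]; first by case/negP: (nK _ m2).
  - by move: n12; rewrite /i2 px eqxx.
  - have [_ [/negP n1 _ _]] := FyP _ (idx1 o);
      have [_ [/negP n3 _ _]] := FyP _ (idx3 o).
    by case.
  - by move: n32; rewrite /i2 px eqxx.
have offz o : z \notin W o.
  apply/negP => /inW[] [_ px]; first by case/negP: (nK _ m3).
  - by move: n13; rewrite /i3 px eqxx.
  - by move: n32; rewrite /i3 px eqxx.
  - have [_ [/negP nz _ _]] := FzP _ (idx2z o); exact: nz.
exists I0, W; split.
- by rewrite card_sig cK.
- by move=> o; apply/subsetP => v /inW[] [].
- move=> [j jK]; have [j2 jx jz jJ] := KP _ jK.
  have entry i t : t \in block part U i /\ part (mate t) = j ->
      mate t \in block part U j /\ e (mate t) t.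
    rewrite !blockE => -[/andP[tU _] pmt]; have [mtU et _ _] := mate_in tU.
    by rewrite mtU pmt eqxx e_sym.
  have [mx ex] := entry _ _ (txP _ jx); have [mz ez] := entry _ _ (tzP _ jz).
  have [my' ey'] := entry _ _ (tyP _ j2).
  have [_ rx] := FxP _ jx; have [_ rz] := FzP _ jz; have [_ ry] := FyP _ j2.
  have [l1 [vx vxF evx]] := reaches_extend e_sym (block_linked jJ) mx ex rx.
  have my2 := subsetP (subsetUl _ (Fx j)) _ my'.
  have [l2 [vy vyF evy]] := reaches_extend e_sym l1 my2 ey' ry.
  have mz2 := subsetP (subsetUl _ (Fy j)) _ (subsetP (subsetUl _ (Fx j)) _ mz).
  have [l3 [vz vzF evz]] := reaches_extend e_sym l2 mz2 ez rz.
  have eW : W (Some (exist _ j jK)) = block part U j :|: Fx j :|: Fy j :|: Fz j.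
    by rewrite /W /= setUid.
  split.
  + rewrite disjoints_subset; apply/subsetP => s.
    by case/setUP => [/set2P[]|/set1P] ->; rewrite in_setC ?offx ?offy ?offz.
  + by rewrite eW.
  + move=> s; rewrite eW; case/setUP => [/set2P[]|/set1P] ->.
    * by exists vx; rewrite // in_setU (in_setU _ _ (Fy j)) vxF.
    * by exists vy; rewrite // in_setU vyF.
    * by exists vz.
- have [_ /(reaches_linked e_sym)[lx bx]] := FxP _ (idx2x None).
  have [_ /(reaches_linked e_sym)[lz bz]] := FzP _ (idx2z None).
  have [_ /(reaches_linked e_sym)[l1 b1]] := FyP _ (idx1 None).
  have [_ /(reaches_linked e_sym)[l3 b3]] := FyP _ (idx3 None).
  rewrite /= in lx bx lz bz l1 b1 l3 b3.
  have crossing i : i \in J :\ i2 -> e (mate (ty i)) (ty i).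
    case/tyP; rewrite blockE => /andP[tU _] _.
    by have [_ + _ _] := mate_in tU; rewrite e_sym.
  have l12 := linkedU e_sym lx l1 bx b1; rewrite tx2 in l12.
  have {}l12 := l12 (or_intror (crossing _ (idx1 None))).
  have l123 := linkedU e_sym l12 l3 (u := y) (v := y);
    rewrite !in_setU !in_set1 eqxx !orbT in l123.
  have {}l123 := l123 isT isT (or_introl erefl).
  have l1234 := linkedU e_sym l123 lz (u := ty i3) (v := tz i2).
  rewrite [X in linked X](_ : _ =
    (x |: Fx i2) :|: (y |: Fy i1) :|: (y |: Fy i3) :|: (z |: Fz i2)).
    apply: l1234; rewrite // ?tz2; first by rewrite in_setU b3 orbT.
    by right; rewrite e_sym; apply: crossing (idx3 None).
  apply/setP => v; rewrite !inE /=.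
  case: (v == x); case: (v == y); case: (v == z); case: (v \in Fx i2);
    case: (v \in Fy i1) => //=; by rewrite ?orbT ?orbF.
move=> o o' v vo vo'.
have idx_inj i : i \in [set i1; i2; i3] -> idx i o = idx i o' -> o = o'.
  move=> /nK iK; case: (o) (o') => [[j jK]|] [[j' jK']|] //= ejj.
  - by congr Some; apply: val_inj.
  - by rewrite -ejj jK in iK.
  - by rewrite ejj jK' in iK.
have Ki v0 i : i \in [set i1; i2; i3] -> part v0 = i -> part v0 \in K -> False.
  by move=> /nK iK ->; apply/negP.
have d12 : i1 <> i2 by apply/eqP.
have d32 : i3 <> i2 by apply/eqP.
have d13 : i1 <> i3 by apply/eqP.
(* The block of a common vertex v decides which parts of the two sets contain it,
   and the parts inside one block are disjoint. *)
case: (inW o v vo) => [[_ p c] | [_ p c] | [_ p c] | [_ p c]];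
  case: (inW o' v vo') => [[_ p' c'] | [_ p' c'] | [_ p' c'] | [_ p' c']];
  try by [case: (Ki v i1) | case: (Ki v i2) | case: (Ki v i3)
         | case: d12; rewrite -p -p' | case: d32; rewrite -p -p'
         | case: d13; rewrite -p -p' | case: d12; rewrite -p' -p
         | case: d32; rewrite -p' -p | case: d13; rewrite -p' -p].
- move: c c'; case: (o) (o') => [[j jK]|] [[j' jK']|] //=; rewrite ?inE //.
  by move=> /andP[_ /eqP pj] /andP[_ /eqP pj']; congr Some; apply: val_inj;
    rewrite /= -pj.
- by apply: (idx_inj i2) => //; apply: disFx c c'.
- have idx13 p1 p2 : idx i1 p1 = idx i3 p2 -> p1 = p2.
    case: p1 p2 => [[j jK]|] [[j' jK']|] //= ejj.
    - by congr Some; apply: val_inj.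
    - by case/negP: (nK _ m3); rewrite -ejj.
    - by case/negP: (nK _ m1); rewrite ejj.
  case: c c' => [c|c] [c'|c'].
  - by apply: (idx_inj i1) => //; apply: disFy c c'.
  - by apply: idx13; apply: disFy c c'.
  - by apply/esym/idx13; apply: disFy c' c.
  - by apply: (idx_inj i3) => //; apply: disFy c c'.
- by apply: (idx_inj i2) => //; apply: disFz c c'.
Qed.

End Step.

Lemma kconnected_layered d U : layered d U -> kconnected e d U.
Proof.
elim=> {d U} [d U _ clU X _ | d U I part mate J mU cJ _ kb];
  last exact: kconnected_step mU cJ kb.
by apply: clique_linked => u v; rewrite !inE => /andP[_ uU] /andP[_ vU]; apply: clU.
Qed.

Lemma degree_layered d U : layered d U ->
  {in U, forall u, d <= #|[set v in U | e u v]|}.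
Proof.
elim=> {d U} [d U cU clU u uU | d U I part mate J mU cJ _ db];
  last exact: degree_step mU db.
rewrite -ltnS -cU (cardsD1 u) uU add1n ltnS; apply: subset_leq_card.
by apply/subsetP => v; rewrite !inE => /andP[vu vU]; rewrite vU clU // eq_sym.
Qed.

Lemma packing_clique d U S :
  #|U| = d.+3 -> {in U &, forall u v, u != v -> e u v} -> S \subset U -> #|S| = 3 ->
  packing e S U d.
Proof.
move=> cU clU SU cS; have clS : linked S.
  by apply: clique_linked => u v uS vS; apply: clU; apply: (subsetP SU).
exists {x : T | x \in U :\: S}, (fun o => if o is Some x then [set val x] else set0).
split=> [|[[x xUS]|]|[x xUS]||].
- by rewrite card_sig; have := cardsID S U; rewrite (setIidPr SU) cU cS => -[].
- by rewrite sub1set; have := xUS; rewrite inE => /andP[].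
- exact: sub0set.
- have [xS xU] : x \notin S /\ x \in U by apply/andP; move: xUS; rewrite inE.
  split=> [||s sS]; first by rewrite disjoint_sym disjoints1.
    exact: linked1.
  exists x; first exact: set11.
  apply: clU => //; first exact: (subsetP SU).
  by apply: contraNneq xS => ->.
- by rewrite set0U.
move=> [[x xUS]|] [[x' xUS']|] v //=; rewrite ?inE // => /eqP vx /eqP vx'.
by congr Some; apply: val_inj; rewrite /= -vx.
Qed.

Lemma layered1_card U : layered 1 U -> #|U| = 2.
Proof. by move=> lU; inversion lU. Qed.

(** The base case is a clique, where the vertices off [S] are the bridges.  The
    induction hypothesis is used only when [S] lies in one block; a block of degree
    1 has just two vertices, so then the degree is large enough for it to apply. *)
Theorem packing_layered d U S :
  layered d.+2 U -> S \subset U -> #|S| = 3 -> packing e S U d.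
Proof.
move eqn: d.+2 => n lU.
elim: lU d eqn S => {n U} [n U cU clU | n U I part mate J mU cJ lb IH] d eqn S SU cS.
  by apply: packing_clique => //; rewrite cU -eqn.
case: eqn => eqn; subst n.
have kb j : j \in J -> kconnected e d.+1 (block part U j).
  by move/lb; apply: kconnected_layered.
have db j : j \in J ->
    {in block part U j, forall u, d < #|[set v in block part U j | e u v]|}.
  by move/lb; apply: degree_layered.
have [x [y [z [eS xy yz xz]]]] := cards3P cS.
have [xU yU zU] : [/\ x \in U, y \in U & z \in U].
  by split; apply: (subsetP SU); rewrite eS !inE eqxx ?orbT.
have xJ : part x \in J by case: mU => + _ _; apply.
have [exy | nxy] := eqVneq (part x) (part y);
  have [exz | nxz] := eqVneq (part x) (part z).
- have Sb : S \subset block part U (part x).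
    apply/subsetP => s sS; rewrite inE (subsetP SU) //=.
    by move: sS; rewrite eS !inE => /orP[/orP[]|] /eqP->; rewrite -?exy -?exz.
  apply: (packing_same mU cJ kb xJ Sb); case: d cJ lb IH kb db => [|d'] cJ lb IH kb db.
    by have := subset_leq_card Sb; rewrite cS (layered1_card (lb _ xJ)).
  by exists d' => //; apply: (IH _ xJ).
- by rewrite eS; apply: (packing_two_one mU cJ kb) => //; rewrite eq_sym.
- have -> : S = [set x; z; y] by rewrite eS -!setUA (setUC [set y]).
  by apply: (packing_two_one mU cJ kb) => //; rewrite eq_sym.
have [eyz | nyz] := eqVneq (part z) (part y).
  have -> : S = [set y; z; x] by rewrite eS -!setUA setUC setUA.
  by apply: (packing_two_one mU cJ kb) => //; rewrite eq_sym.
by rewrite eS; apply: (packing_distinct mU cJ kb).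
Qed.

End Layered.

(** * From connected sets to trees *)

Section Trees.
Variable G : sgraph.
Implicit Types (S V W : {set G}) (E : {set {set G}}) (H : pregraph G).

Lemma edge_rel_sym E : symmetric (edge_rel E).
Proof. by move=> u v; rewrite /edge_rel setUC. Qed.

Lemma edge_mem (u v : G) : adj u v -> [set u; v] \in edges G.
Proof. by move=> uv; apply: imset2_f. Qed.

(** An inclusion-minimal connected edge set is acyclic: an edge of a cycle can be
    replaced by the rest of the cycle. *)
Lemma spanning_tree H :
  is_subgraph H -> H.1 != set0 -> connected H ->
  exists E, E \subset H.2 /\ is_tree (H.1, E).
Proof.
case: H => V E /= /andP[/= Eed /forall_inP EV] V0 conE.
have [E' minE E'E] := minset_exists (P := fun E => connected (V, E)) conE.
have {minE} [conE' minE'] := minsetP minE.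
exists E'; split=> //; apply/and4P; split=> //=.
  apply/andP; split; first exact: subset_trans E'E Eed.
  by apply/forall_inP => A /(subsetP E'E) /EV.
apply/acyclicP => c /andP[cyc unc]; rewrite leqNgt; apply/negP => c2.
case: c c2 cyc unc => [|x [|y [|w p]]] //= _ cyc unc.
set A := [set x; y]; pose E1 := E' :\ A.
have AE' : A \in E' by case/andP: cyc.
have xy1 : connect (edge_rel E1) y x.
  apply/connectP; exists (rcons (w :: p) x); last by rewrite last_rcons.
  have neA u v : [set u; v] \in E' -> ~~ ((u \in A) && (v \in A)) -> edge_rel E1 u v.
    move=> uvE' nA; rewrite /edge_rel !inE uvE' andbT; apply: contra nA => /eqP <-.
    by rewrite !inE !eqxx orbT.
  case/and3P: cyc => _ yw pw; case/and4P: unc.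
  rewrite !inE !negb_or => /and3P[xy xw xp] /andP[yw' yp] wp up.
  rewrite /= neA //=; last by rewrite !inE (eq_sym w) (negPf xw) (eq_sym w) (negPf yw')
    andbF.
  have {}pw : path (edge_rel E') w p && edge_rel E' (last w p) x.
    by move: pw; rewrite rcons_path.
  rewrite rcons_path; case/andP: pw => pw lx; apply/andP; split.
    apply: (sub_in_path (P := [pred u | u \notin A])) pw => [u v uA vA uv | ].
      have uA' : u \notin A := uA.
      by apply: neA; rewrite // negb_and uA'.
    rewrite /= !inE negb_or (eq_sym w) xw (eq_sym w) yw' /=; apply/allP => u up' /=.
    by rewrite !inE negb_or; apply/andP; split;
      [apply: contraNneq xp => <- | apply: contraNneq yp => <-].
  apply: neA => //; rewrite !inE negb_and negb_or; apply/orP; left.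
  have := mem_last w p; rewrite inE => /predU1P[-> | lp];
    first by rewrite (eq_sym w) xw (eq_sym w) yw'.
  by apply/andP; split; [apply: contraNneq xp => <- | apply: contraNneq yp => <-].
have csym := sym_connect_sym (@edge_rel_sym E1).
have conE1 : connected (V, E1).
  apply/forall_inP => u uV; apply/forall_inP => v vV.
  have := forall_inP (forall_inP conE' u uV) v vV; apply: connect_sub => a b /= ab.
  have [eA | neA] := eqVneq [set a; b] A; last by apply: connect1;
    rewrite /edge_rel !inE neA.
  have /set2P[-> | ->] : a \in A by rewrite -eA !inE eqxx.
    have /set2P[-> | ->] : b \in A by rewrite -eA !inE eqxx orbT.
      exact: connect0.
    by rewrite csym.
  have /set2P[-> // | ->] : b \in A by rewrite -eA !inE eqxx orbT.
  exact: connect0.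
have := minE' E1 conE1 (subsetDl _ _) => eE.
by move: AE'; rewrite -eE !inE eqxx.
Qed.

(** An edge common to two of the trees would lie inside [S], and such edges are left
    to the tree at [None]. *)
Lemma packing_kappa S U r : 1 < #|S| ->
  packing (@adj G) S U r -> r < kappa S.
Proof.
move=> S1 [I [W [cI _ bW l0 disW]]]; apply/(leq_kappa _ S1).
have [s0 s0S] : exists s, s \in S by apply/card_gt0P; apply: leq_trans S1.
pose V o := W o :|: S.
pose E o := [set A in edges G | (A \subset V o) && ((o == None) || ~~ (A \subset S))].
have subE o : is_subgraph (V o, E o).
  apply/andP; split; first by apply/subsetP => A; rewrite inE => /andP[].
  by apply/forall_inP => A; rewrite inE => /and3P[].
have V0 o : V o != set0 by apply/set0Pn; exists s0; rewrite !inE s0S orbT.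
have conE o : connected (V o, E o).
  case: o => [i|]; apply/forall_inP => u uV; apply/forall_inP => v vV; last first.
    have := linkedP _ _ l0 u v uV vV; apply: connect_sub => a b /and3P[aV bV ab].
    apply: connect1; rewrite /edge_rel inE edge_mem //= andbT.
    by apply/subsetP => t /set2P[]->.
  have [dW lW nW] := bW i; have [w wW _] := nW s0 s0S.
  have csym := sym_connect_sym (@edge_rel_sym (E (Some i))).
  have toE a b : a \in W (Some i) -> b \in V (Some i) -> adj a b ->
    edge_rel (E (Some i)) a b.
    move=> aW bV ab; rewrite /edge_rel inE edge_mem //=; apply/andP; split.
      by apply/subsetP => t /set2P[]-> //; rewrite inE aW.
    apply/subsetPn; exists a; rewrite ?inE ?eqxx //.
    by rewrite (disjointFl dW aW).
  have inW a : a \in W (Some i) -> connect (edge_rel (E (Some i))) w a.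
    move=> aW; have := linkedP _ _ lW w a wW aW;
      apply: connect_sub => b c /and3P[bW' cW bc].
    by apply/connect1/toE; rewrite // inE cW.
  have hub a : a \in V (Some i) -> connect (edge_rel (E (Some i))) w a.
    rewrite inE => /orP[/inW // | aS]; have [b bW' ba] := nW a aS.
    by apply: connect_trans (inW b bW') (connect1 (toE _ _ bW' _ ba));
      rewrite inE aS orbT.
  by apply: connect_trans (hub v vV); rewrite csym hub.
have /fin_all_exists[t tP] : forall o, exists E', E' \subset E o /\ is_tree (V o, E').
  by move=> o; have := spanning_tree (subE o) (V0 o) (conE o).
have cO : r.+1 = #|{: option I}| by rewrite card_option cI.
pose ix (i : 'I_r.+1) : option I := enum_val (cast_ord cO i).
exists (fun i => (V (ix i), t (ix i))); split=> [i | i j ij] /=.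
  by have [_ ?] := tP (ix i); split=> //; apply: subsetUr.
have {}ij : ix i != ix j by apply: contraNneq ij => /enum_val_inj/cast_ord_inj->.
split; last first.
  apply/setP => v; rewrite !inE; case vS: (v \in S); rewrite ?orbT // !orbF.
  by apply/negP => /andP[vi vj]; rewrite (disW _ _ _ vi vj) eqxx in ij.
rewrite disjoints_subset; apply/subsetP => A At; rewrite inE; apply/negP => At'.
have [/subsetP/(_ _ At) + _] := tP (ix i); have [/subsetP/(_ _ At') + _] := tP (ix j).
rewrite !inE => /and3P[_ Aj oj] /and3P[_ Ai oi].
have AS : A \subset S.
  apply/subsetP => v vA; have := subsetP Ai v vA; have := subsetP Aj v vA; rewrite !inE.
  case: (v \in S); rewrite ?orbT // !orbF => vj vi.
  by rewrite (disW _ _ _ vi vj) eqxx in ij.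
move: ij oi oj; rewrite AS !orbF => ij /eqP oi /eqP oj.
by rewrite oi oj eqxx in ij.
Qed.

Lemma connect_exit (T : finType) (e : rel T) (A : {set T}) x z :
  connect e x z -> x \in A -> z \notin A ->
    exists u v, [/\ u \in A, v \notin A & e u v].
Proof.
case/connectP=> p; elim: p x => [|y p IH] x /= => [_ -> -> // | /andP[exy py] ez xA zA].
have [yA | yA] := boolP (y \in A); first exact: IH ez yA zA.
by exists x, y.
Qed.

(** If [D] trees existed, each would use exactly one edge at [x] and one at [y].  The
    tree with the edge xy could then not leave these two vertices. *)
Lemma kappa_adjacent D (x y z : G) :
  adj x y -> z != x -> z != y ->
  #|[set v | adj x v]| <= D -> #|[set v | adj y v]| <= D ->
  kappa [set x; y; z] < D.
Proof.
move=> xy zx zy degx degy; rewrite ltnNge; apply/negP; set S := [set x; y; z].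
have S1 : 1 < #|S|.
  apply/card_gt1P; exists z, x; split=> //; by rewrite !inE eqxx ?orbT.
move/(leq_kappa _ S1) => [t [tP disT]].
have [xS yS zS] : [/\ x \in S, y \in S & z \in S] by rewrite !inE !eqxx !orbT.
have subE i A : A \in (t i).2 -> A \in edges G.
  by have [/and4P[/andP[/subsetP sE _] _ _ _] _] := tP i; apply: sE.
have adjE i u v : [set u; v] \in (t i).2 -> u != v -> adj u v.
  move=> /subE/imset2P[a b _ ab euv] uv.
  have /set2P ua : u \in [set a; b] by rewrite -euv !inE eqxx.
  have /set2P va : v \in [set a; b] by rewrite -euv !inE eqxx orbT.
  have ab' : adj a b by [].
  by case: ua uv => ->; case: va => ->; rewrite ?eqxx // adj_sym.
have con i u v : u \in S -> v \in S -> connect (edge_rel (t i).2) u v.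
  have [/and4P[_ _ /forall_inP cT _] /subsetP sT] := tP i.
  by move=> /sT uV /sT vV; apply: (forall_inP (cT u uV)).
have same i j A : A \in (t i).2 -> A \in (t j).2 -> i = j.
  move=> Ai Aj; apply/eqP; apply: contraT => /disT[+ _].
  by rewrite disjoints_subset => /subsetP/(_ _ Ai); rewrite inE Aj.
(* D trees at a vertex of degree at most D use each of its edges exactly once. *)
have all_nbrs s :
    s \in S -> (exists2 s', s' \in S & s' != s) -> #|[set v | adj s v]| <= D ->
    exists f : 'I_D -> G, (forall i, [set s; f i] \in (t i).2) /\
      forall v, adj s v -> exists i, f i = v.
  move=> sS [s' s'S s's] degs.
  have /fin_all_exists[f fP] : forall i, exists v, [set s; v] \in (t i).2 /\ v != s.
    move=> i; have [||u [v [/set1P-> vs sv]]] :=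
      @connect_exit _ _ [set s] s s' (con i s s' sS s'S); rewrite ?inE //.
    by exists v; split=> //; move: vs; rewrite inE.
  have injf : injective f.
    move=> i j eij; apply: (same i j [set s; f i]); first by case: (fP i).
    by rewrite eij; case: (fP j).
  have fN i : f i \in [set v | adj s v].
    by have [? ?] := fP i; rewrite inE; apply: (@adjE i); rewrite // eq_sym.
  have cN : #|[set v | adj s v]| = D.
    apply/eqP; rewrite eqn_leq degs /= -[X in X <= _]card_ord -(card_imset _ injf).
    by apply: subset_leq_card; apply/subsetP => _ /imsetP[i _ ->].
  exists f; split=> [i|v sv]; first by case: (fP i).
  by apply: (onto_of_card injf fN cN); rewrite inE.
have [|fx [fxE fxN]] := all_nbrs x xS _ degx; first by exists z.
have [|fy [fyE fyN]] := all_nbrs y yS _ degy; first by exists z.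
have [i fxi] := fxN y xy; have xyi : [set x; y] \in (t i).2 by rewrite -fxi.
have fyi : fy i = x.
  have [|j fyj] := fyN x; first by rewrite adj_sym.
  by rewrite (same i j [set x; y]) // setUC -fyj.
have [||u [v [uA vA]]] := @connect_exit _ _ [set x; y] x z (con i x z xS zS).
- by rewrite !inE eqxx.
- by rewrite !inE negb_or zx.
rewrite /edge_rel => uvi.
have uv : u != v by apply: contraNneq vA => <-.
have auv := adjE i u v uvi uv.
case/set2P: uA => eu; rewrite eu in uvi auv.
  have [j fj] := fxN v auv; move: (fxE j); rewrite fj => /(same _ _ _ uvi) ij.
  by move: vA; rewrite -fj -ij fxi !inE eqxx orbT.
have [j fj] := fyN v auv; move: (fyE j); rewrite fj => /(same _ _ _ uvi) ij.
by move: vA; rewrite -fj -ij fyi !inE eqxx.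
Qed.

End Trees.

(** * The bubble-sort graph *)

Section Bubble.
Variables n k : nat.
Hypothesis kn : k < n.
Implicit Types (a b u v w : arrangement n k) (p q i j : 'I_k) (c : 'I_n).

Definition at_pos (u : arrangement n k) (i : 'I_k) : 'I_n := tnth (val u) i.

Lemma at_pos_inj u : injective (at_pos u).
Proof. exact/tuple_uniqP/(valP u). Qed.

Lemma arrangement_ext u v : at_pos u =1 at_pos v -> u = v.
Proof. by move=> uv; apply/val_inj/eq_from_tnth. Qed.

Lemma arrangement_of (f : 'I_k -> 'I_n) : injective f -> exists u, at_pos u =1 f.
Proof.
move=> injf; have uf : uniq (mktuple f).
  by apply/tuple_uniqP => i j; rewrite !tnth_mktuple => /injf.
by exists (Sub (mktuple f) uf : arrangement n k) => i;
  rewrite /at_pos SubK tnth_mktuple.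
Qed.

Lemma permute_positions u (s : {perm 'I_k}) :
  exists v, forall i, at_pos v i = at_pos u (s i).
Proof. by apply: arrangement_of; apply: inj_comp (@at_pos_inj u) (@perm_inj _ s). Qed.

Lemma permute_symbols u (s : {perm 'I_n}) :
  exists v, forall i, at_pos v i = s (at_pos u i).
Proof. by apply: arrangement_of; apply: inj_comp (@perm_inj _ s) (@at_pos_inj u). Qed.

Lemma bubble_adjP u v :
  reflect
    ((exists p q, val q = (val p).+1 /\
        forall i, at_pos v i = at_pos u (tperm p q i)) \/
     (exists p, [/\ val p = 0, at_pos u p != at_pos v p
                  & forall i, i != p -> at_pos u i = at_pos v i]))
    (bubble_adj u v).
Proof.
apply: (iffP orP) => -[].
- case/existsP=> p /existsP[q /and4P[/eqP pq /eqP up /eqP uq /forallP rest]].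
  left; exists p, q; split=> // i; case: tpermP => [-> | -> | /eqP ip /eqP iq] //.
  by apply/esym/eqP/(implyP (rest i)); rewrite ip iq.
- case/existsP=> p /and3P[/eqP p0 up /forallP rest]; right; exists p; split=> // i ip.
  by apply/eqP; apply: (implyP (rest i)).
- case=> p [q [pq vE]]; left; apply/existsP; exists p; apply/existsP; exists q.
  apply/and4P; split; rewrite ?pq //.
  + by rewrite -/(at_pos v q) vE tpermR.
  + by rewrite -/(at_pos v p) vE tpermL.
  apply/forallP => i; apply/implyP => /andP[ip iq].
  by rewrite -/(at_pos v i) vE tpermD // eq_sym.
- case=> p [p0 up rest]; right; apply/existsP; exists p; rewrite p0 up eqxx /=.
  by apply/forallP => i; apply/implyP => ip; apply/eqP; apply: rest.
Qed.

(** The arrangements that agree with [a] from position [h] on.  A reference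
    arrangement in place of a word of length k - h keeps all entries indexed by
    positions. *)
Definition cell a h : {set arrangement n k} :=
  [set u | [forall i : 'I_k, (h <= i) ==> (at_pos u i == at_pos a i)]].

Lemma cellP a h u :
  reflect (forall i, h <= i -> at_pos u i = at_pos a i) (u \in cell a h).
Proof.
rewrite inE; apply: (iffP forallP) => [ua i hi | ua i]; last by apply/implyP => /ua->.
by apply/eqP; apply: (implyP (ua i)).
Qed.

Definition free_symbols a h : {set 'I_n} := ~: [set at_pos a i | i : 'I_k & h <= i].

Lemma free_symbolsP a h c :
  reflect (forall i, h <= i -> at_pos a i != c) (c \in free_symbols a h).
Proof.
rewrite inE; apply: (iffP idP) => [nc i hi | nc].
  by apply: contraNneq nc => <-; apply: imset_f; rewrite inE.
by apply/negP => /imsetP[i]; rewrite inE => /nc/negP ne ec; apply: ne; rewrite ec.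
Qed.

Lemma card_free_symbols a h : h <= k -> #|free_symbols a h| = n - (k - h).
Proof.
move=> hk; have := cardsC [set at_pos a i | i : 'I_k & h <= i].
rewrite card_imset ?card_ord; last exact: at_pos_inj.
have := cardsC [set i : 'I_k | h <= i]; rewrite card_ord.
have -> : ~: [set i : 'I_k | h <= i] = [set widen_ord hk i | i : 'I_h].
  apply/setP => i; rewrite !inE -ltnNge; apply/idP/imsetP => [ih | [j _ ->]];
    last exact: ltn_ord j.
  by exists (Ordinal ih) => //; apply: val_inj.
rewrite card_imset ?card_ord; last by move=> i j /(congr1 val) /= /val_inj.
by rewrite /free_symbols; move: #|[set i : 'I_k | _]| #|~: _| => x y; lia.
Qed.

(** Exchange the symbols [c] and [at_pos a p] throughout [a]: this works whether or
    not [c] occurs before position [p]. *)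
Lemma place_symbol a p c :
  c \in free_symbols a p.+1 ->
  exists2 u, at_pos u p = c & forall i, p < i -> at_pos u i = at_pos a i.
Proof.
move/free_symbolsP=> fc; have [u uE] := permute_symbols a (tperm (at_pos a p) c).
exists u => [|i pi]; rewrite uE ?tpermL //.
rewrite tpermD // 1?eq_sym ?fc //; apply: contraTneq pi => /at_pos_inj->.
by rewrite ltnn.
Qed.

Lemma cell1_layered a : 0 < k -> layered (@bubble_adj n k) (n - k) (cell a 1).
Proof.
move=> k0; pose p0 := Ordinal k0; apply: LayeredClique => [|u v /cellP uC /cellP vC uv].
  have -> : (n - k).+1 = #|free_symbols a 1| by rewrite card_free_symbols //; lia.
  have injf : {in cell a 1 &, injective (fun u => at_pos u p0)}.
    move=> u v /cellP uC /cellP vC uv; apply: arrangement_ext => i.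
    have [-> // | ip] := eqVneq i p0; rewrite uC ?vC // lt0n; exact: ip.
  rewrite -(card_in_imset injf); congr #|pred_of_set _|.
  apply/setP => c; apply/imsetP/idP => [[u /cellP uC ->] | fc].
    apply/free_symbolsP => i hi; rewrite -uC //; apply: contraTneq hi => /at_pos_inj->.
    by [].
  have [u <- uE] := place_symbol (p := p0) fc.
  by exists u => //; apply/cellP.
apply/bubble_adjP; right; exists p0; split=> // [|i ip]; last by rewrite uC ?vC // lt0n.
apply: contraNneq uv => uv0; apply/eqP/arrangement_ext => i.
by have [-> // | ip] := eqVneq i p0; rewrite uC ?vC // lt0n.
Qed.

(** Blocks are given by the entry at the last free position [p], mates by exchanging
    [p] with the position [q] before it. *)
Lemma cell_layered a h :
  0 < h -> h <= k -> layered (@bubble_adj n k) (n - 1 - (k - h)) (cell a h).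
Proof.
case: h => // h _; elim: h a => [|h IH] a hk.
  rewrite (_ : n - 1 - (k - 1) = n - k); [exact: cell1_layered | lia].
pose q : 'I_k := Ordinal (ltnW hk); pose p : 'I_k := Ordinal hk.
have pq : p != q by rewrite -val_eqE /= eqn_leq ltnn.
have [d dE] : exists d, n - 1 - (k - h.+2) = d.+2 by exists (n - 3 - (k - h.+2)); lia.
have dE' : n - 1 - (k - h.+1) = d.+1 by lia.
have /fin_all_exists[mate mateE] :
  forall u, exists v, forall i, at_pos v i = at_pos u (tperm q p i).
  by move=> u; apply: permute_positions.
have mateK u : mate (mate u) = u.
  by apply: arrangement_ext => i; rewrite !mateE tpermK.
rewrite dE; apply: (LayeredStep (part := fun u => at_pos u p) (mate := mate)
                                (J := free_symbols a h.+2)).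
- split=> [u /cellP uC | u /cellP uC | c c' fc fc' cc'].
  + apply/free_symbolsP => i hi; rewrite -uC //; apply: contraTneq hi => /at_pos_inj->.
    by rewrite /= ltnn.
  + split=> //.
    * apply/cellP => i hi; rewrite mateE tpermD ?uC // -val_eqE /= neq_ltn; apply/orP;
        left; lia.
    * by apply/bubble_adjP; left; exists q, p.
    * by rewrite mateE tpermR; apply: contraNneq pq => /at_pos_inj->.
  have [b bp bC] := place_symbol (p := p) fc.
  have [|u uq uC] := @place_symbol b q c'.
    apply/free_symbolsP => i; rewrite leq_eqVlt => /predU1P[ip | hi].
      by have -> : i = p; [apply: val_inj | rewrite bp].
    by rewrite bC //; apply: (free_symbolsP _ _ _ fc').
  exists u; last by rewrite mateE tpermR uq uC.
  by apply/cellP => i hi; rewrite uC ?bC //=; lia.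
- by rewrite card_free_symbols //; lia.
move=> c fc; have [b bp bC] := place_symbol (p := p) fc.
rewrite -dE'; suff -> : block (fun u => at_pos u p) (cell a h.+2) c = cell b h.+1.
  by apply: IH; apply: ltnW.
apply/setP => u; rewrite inE; apply/andP/cellP => [[/cellP uC /eqP up] i | uC].
  rewrite leq_eqVlt => /predU1P[ip | hi]; last by rewrite uC // bC.
  by have -> : i = p; [apply: val_inj | rewrite bp].
split; last by rewrite uC // bp.
by apply/cellP => i hi; rewrite uC ?bC //; apply: ltnW.
Qed.

Lemma bubble_layered a :
  0 < k -> layered (@bubble_adj n k) (n - 1) [set: arrangement n k].
Proof.
move=> k0; have := @cell_layered a k k0 (leqnn k); rewrite subnn subn0.
suff -> : cell a k = setT by [].
by apply/setP => u; rewrite [RHS]inE; apply/cellP => i; rewrite leqNgt ltn_ord.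
Qed.

(** A neighbour of [u] is determined by the symbol that moves towards the front: an
    entry of [u] moving one place down, or a new symbol put in front.  It can be any
    symbol other than the first entry of [u]. *)
Lemma bubble_degree u : 0 < k -> #|[set v | bubble_adj u v]| <= n - 1.
Proof.
move=> k0; pose p0 := Ordinal k0.
have /fin_all_exists[h hP] : forall c, exists w,
    (forall p q, val q = (val p).+1 -> at_pos u q = c ->
       forall i, at_pos w i = at_pos u (tperm p q i)) /\
    ((forall q, at_pos u q != c) ->
       at_pos w p0 = c /\ forall i, i != p0 -> at_pos w i = at_pos u i).
  move=> c; case: (pickP (fun pq : 'I_k * 'I_k =>
      (val pq.2 == (val pq.1).+1) && (at_pos u pq.2 == c)))
    => [[p q] /= /andP[/eqP pq /eqP uq] | no].
    have [w wE] := permute_positions u (tperm p q).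
    exists w; split=> [p' q' pq' uq' i | nq]; last by have := nq q; rewrite uq eqxx.
    have eq : q' = q by apply: (@at_pos_inj u); rewrite uq uq'.
    have ep : p' = p by apply: val_inj; apply/eqP; rewrite -eqSS -pq -pq' eq.
    by rewrite eq ep.
  have noq p q : val q = (val p).+1 -> at_pos u q = c -> False.
    by move=> pq uq; have := no (p, q); rewrite /= pq uq !eqxx.
  have [/forallP free | nfree] := boolP [forall q, at_pos u q != c]; last first.
    exists u; split=> [p q pq /(noq _ _ pq) // | fr].
    by case/negP: nfree; apply/forallP.
  have [|w w0 wC] := @place_symbol u p0 c; first by apply/free_symbolsP => i _.
  exists w; split=> [p q pq /(noq _ _ pq) // | _]; split=> // i ip.
  by rewrite wC //= lt0n.
have sub : [set v | bubble_adj u v] \subset h @: [set~ at_pos u p0].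
  apply/subsetP => v; rewrite inE => /bubble_adjP[[p [q [pq vE]]] | [p [p0' up vE]]];
    apply/imsetP.
    exists (at_pos u q).
      by rewrite !inE; apply/eqP => /at_pos_inj/(congr1 val); rewrite /= pq.
    by apply: arrangement_ext => i; rewrite vE; have [hq _] := hP (at_pos u q);
      rewrite (hq p q).
  have ep : p = p0 by apply: val_inj.
  rewrite ep {p p0' ep} in up vE.
  exists (at_pos v p0); first by rewrite !inE eq_sym.
  have [_ [q | h0 hi]] := hP (at_pos v p0).
    by have [-> // | qp] := eqVneq q p0; rewrite vE //;
      apply: contraNneq qp => /at_pos_inj->.
  by apply: arrangement_ext => i; have [-> // | ip] := eqVneq i p0; rewrite hi // vE.
apply: leq_trans (subset_leq_card sub) (leq_trans (leq_imset_card _ _) _).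
by rewrite cardsC1 card_ord; lia.
Qed.

End Bubble.

Theorem theorem2 (n k : nat) (hk : 3 <= k) (hkn : k <= n - 1) :
  kappa3 (bubble_sort_graph n k) = n - 2.
Proof.
have kn : k < n by lia.
have k0 : 0 < k by lia.
have [a _] : exists a : arrangement n k, at_pos a =1 widen_ord (ltnW kn).
  by apply: arrangement_of => i j /(congr1 val) /= /val_inj.
have lay := bubble_layered kn a k0.
have [d dE] : exists d, n - 1 = d.+2 by exists (n - 3); lia.
rewrite dE in lay; have degG := degree_layered lay.
set G := bubble_sort_graph n k.
have [y [z [ay az yz]]] : exists y z : G, [/\ adj (a : G) y, adj (a : G) z & y != z].
  have /card_gt1P[y [z [yN zN yz]]] : 1 < #|[set v in [set: G] | adj (a : G) v]|.
    by apply: leq_trans (degG a (in_setT a)).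
  by exists y, z; move: yN zN; rewrite !inE.
have nza : z != a by apply: contraTneq az => ->; rewrite adj_irrefl.
have nya : y != a by apply: contraTneq ay => ->; rewrite adj_irrefl.
have cS : #|[set (a : G); y; z]| = 3.
  by rewrite setUC cardsU1 cards2 !inE (negPf nza) eq_sym (negPf yz) eq_sym nya.
have G3 : 2 < #|G| by rewrite -cS max_card.
have [[S cS' kS] min3] := kappa3_min G3.
apply/eqP; rewrite eqn_leq; apply/andP; split.
  apply: leq_trans (min3 _ cS) _; rewrite -ltnS.
  have -> : (n - 2).+1 = n - 1 by lia.
  by apply: kappa_adjacent => //;
    [rewrite eq_sym | apply: bubble_degree | apply: bubble_degree].
have -> : n - 2 = d.+1 by lia.
rewrite kS; apply: packing_kappa; first by rewrite cS'.
exact: (packing_layered (@bubble_adj_sym n k) (@bubble_adj_irrefl n k) lay (subsetT _)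
  cS').
Qed.
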